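(* Suppose that $D\subset\mathbb{C}^n$ is a bounded domain and that $u\in \mathrm{PSH}(D)\cap C(\overline{D})$, with a concave modulus of continuity $\omega$. Suppose also that there is a set $E\subset\partial D$ such that each $z\in\partial D\setminus E$ has a neighborhood $U\subset\mathbb{C}^n$ such that $u\in\mathrm{PSH}(\overline{U\cap D})$. If $E$ satisfies $\mathrm{PS}(C,\phi)$ with $\phi(t)=\omega(t)\log(1/t)$, then $u\in\mathrm{PSH}(\overline{D})$.
   Context: $B(a,r)\subset\mathbb{C}^n$ denotes the ball with center $a$ and radius $r$. $\mathrm{PSH}(D)$ denotes the plurisubharmonic functions on $D$, and $\mathrm{PSH}(\overline{D})$ denotes the functions that are uniform limits (on $\overline{D}$) of plurisubharmonic functions defined on (shrinking) neighborhoods of $\overline{D}$; $\mathrm{PSH}(\overline{U\cap D})$ is defined in the same way with $U\cap D$ in place of $D$, and $u\in\mathrm{PSH}(\overline{U\cap D})$ refers to the restriction of $u$ to $\overline{U\cap D}$. A function $\omega:[0,\infty]\to[0,\infty]$ is called a modulus of continuity for a function $u$ defined on a set $X$ if $|u(z)-u(w)|\le\omega(|z-w|)$ for all $z,w\in X$. Here $X=\overline{D}$. Let $C>1$ and $\phi:\mathbb{R}^+\to\mathbb{R}^+$. A set $K$ satisfies $\mathrm{PS}(C,\phi)$ ($K$ is said to be $C$-proportionally well separated of negligible $\phi$-measure) if for each $\epsilon>0$ there exists a set of balls $\mathcal{F}=\{B(z_j,r_j)\}$ such that: (1) $\mathcal{F}$ covers $K$; (2) $\mathcal{F}$ is proportionally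 $C$-separated in the sense that $B(z_j,r_j)\cap B(z_k,Cr_k)=\emptyset$ for all $j\neq k$; (3) $\sum_{j=1}^\infty\phi(r_j)<\epsilon$.
   Formalization: The formula φ(t)=ω(t)log(1/t) is required only for 0<t<t0 with some t0<1; for t≥t0, φ is any function bounded below by a positive constant, since the literal formula vanishes at t=1 and is negative beyond, which lets one large ball cover E at no cost. *)

(* Defs.v *)
From HB Require Import structures.
From mathcomp Require Import all_boot all_order all_algebra complex.
From mathcomp Require Import all_classical all_reals all_analysis.

Set Implicit Arguments.
Unset Strict Implicit.
Unset Printing Implicit Defensive.

Import Order.TTheory GRing.Theory Num.Theory.
Import numFieldNormedType.Exports.

Local Open Scope classical_set_scope.
Local Open Scope ring_scope.
Local Open Scope complex_scope.

(* The topology is inferred from the regular algebra [R[i]^o]; on ['rV_n] it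
   is the product topology, i.e. the usual one on C^n. *)
Notation "'CC[' R ]" := (R[i]^o) (at level 0, format "'CC[' R ]") : type_scope.
Notation "'CC[' R ]_ n" := ('rV[R[i]^o]_n)
  (at level 0, n at level 2, format "'CC[' R ]_ n") : type_scope.

Section defs.
Context {R : realType}.

(* The library norm on matrices is the sup norm. *)
Definition enorm n (z : CC[R]_n) : R :=
  Num.sqrt (\sum_(j < n) Normc.normc (z ord0 j) ^+ 2).

Definition eball n (a : CC[R]_n) (r : R) : set CC[R]_n :=
  [set z | enorm (z - a) < r].

Definition bounded_domain n (D : set CC[R]_n) : Prop :=
  [/\ open D, connected D, D !=set0 &
      exists M : R, forall z, D z -> enorm z <= M].

Definition bdry n (D : set CC[R]_n) : set CC[R]_n := closure D `\` D°.

Definition usc_on (T : topologicalType) (D : set T) (f : T -> \bar R) : Prop :=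
  forall x, D x -> forall a : R, (f x < a%:E)%E ->
    \forall y \near within D (nbhs x), (f y < a%:E)%E.

Definition circle_pt (a : CC[R]) (r t : R) : CC[R] :=
  a + ((r * cos t) +i* (r * sin t)).

(* Subharmonic functions take values in [-oo, +oo[; the constant -oo is
   allowed. The integral of a function that is bounded above on the circle is
   meaningful, and may be -oo. *)
Definition subharmonic (W : set CC[R]) (f : CC[R] -> \bar R) : Prop :=
  [/\ forall z, W z -> (f z < +oo)%E,
      usc_on W f &
      forall (a : CC[R]) (r : R), 0 < r ->
        (forall z : CC[R], Normc.normc (z - a) <= r -> W z) ->
        (f a <= ((2 * pi)^-1)%:E *
           \int[lebesgue_measure]_(t in `[0%R, (2 * pi)%R]) f (circle_pt a r t))%E].

Definition psh n (D : set CC[R]_n) (f : CC[R]_n -> \bar R) : Prop :=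
  [/\ forall z, D z -> (f z < +oo)%E,
      usc_on D f &
      forall a b : CC[R]_n,
        subharmonic [set w : CC[R] | D (a + w *: b)] (fun w => f (a + w *: b))].

(* The class written PSH of the closure of [S]. The approximants may take the
   value -oo off the closure of [S]; the last clause forces them to be
   (eventually) finite on it. *)
Definition psh_closure n (S : set CC[R]_n) (u : CC[R]_n -> R) : Prop :=
  exists (V : nat -> set CC[R]_n) (v : nat -> CC[R]_n -> \bar R),
    [/\ forall j, open (V j) /\ closure S `<=` V j,
        forall i j, (i <= j)%N -> V j `<=` V i,
        forall j, psh (V j) (v j) &
        forall eps : R, 0 < eps -> \forall j \near \oo,
          forall z, closure S z -> (`|v j z - (u z)%:E| <= eps%:E)%E].

Definition modulus_of_continuity n (X : set CC[R]_n) (u : CC[R]_n -> R)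
    (omega : \bar R -> \bar R) : Prop :=
  (forall t, (0 <= t)%E -> (0 <= omega t)%E) /\
  (forall z w, X z -> X w -> (`|u z - u w|%:E <= omega (enorm (z - w))%:E)%E).

Definition concave_modulus (omega : \bar R -> \bar R) : Prop :=
  forall (x y : \bar R) (t : R), (0 <= x)%E -> (0 <= y)%E -> 0 <= t <= 1 ->
    (t%:E * omega x + (1 - t)%:E * omega y
       <= omega (t%:E * x + (1 - t)%:E * y))%E.

(* The family of balls is countable, possibly finite or empty: it is indexed
   by a set [J] of natural numbers. *)
Definition PS n (C : R) (phi : R -> R) (K : set CC[R]_n) : Prop :=
  forall eps : R, 0 < eps ->
  exists (J : set nat) (z : nat -> CC[R]_n) (r : nat -> R),
    [/\ forall j, J j -> 0 < r j,
        K `<=` \bigcup_(j in J) eball (z j) (r j),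
        forall j k, J j -> J k -> j <> k ->
          eball (z j) (r j) `&` eball (z k) (C * r k) = set0 &
        (\esum_(j in J) (phi (r j))%:E < eps%:E)%E].

(* The gauge phi(t) = omega(t) log(1/t). This product tends to 0 as t -> 1 and
   is negative for t > 1, so taken literally for all t > 0 it is not a function
   R+ -> R+ and one large ball would have arbitrarily small phi-mass. As usual
   for gauges of measures, only the germ at 0 is prescribed: beyond an
   arbitrary threshold t0 < 1, [phi] is any function bounded away from 0. *)
Definition log_gauge (omega : \bar R -> \bar R) (phi : R -> R) : Prop :=
  (forall t, 0 < t -> 0 <= phi t) /\
  exists2 t0 : R, 0 < t0 < 1 &
    (forall t, 0 < t < t0 ->
       (phi t)%:E = (omega t%:E * (ln (1 / t))%:E)%E) /\
    (exists2 m : R, 0 < m & forall t, t0 <= t -> m <= phi t).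

End defs.

(* Main.v *)
Require Import Defs.
From HB Require Import structures.
From mathcomp Require Import all_boot all_order all_algebra complex.
From mathcomp Require Import all_classical all_reals all_analysis.
From mathcomp Require Import measurable_realfun.
From mathcomp Require Import ring lra.
Import Order.TTheory GRing.Theory Num.Theory.
Import numFieldNormedType.Exports.
Local Open Scope classical_set_scope.
Local Open Scope ring_scope.
Set Implicit Arguments.
Unset Strict Implicit.
Unset Printing Implicit Defensive.

(** The function [u] is approximated on the closure of [D] by gluing.  Every
    point of the closure outside [E] has a neighbourhood on which [u] is a
    uniform limit of plurisubharmonic functions, and [E] is covered by the
    separated balls B(c_k, r_k).  By compactness finitely many such
    neighbourhoods U_i, centred at a_i, and finitely many balls cover the
    closure.  Near the closure of U_i and [D] one takes an approximant g_i; on a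
    slightly larger concentric ball B(c_k, kappa^4 r_k) one takes the constant
    u(p_k), where p_k is a point of the closure of [D] in the ball; the concave
    modulus bounds the oscillation of [u] there by 2 C omega(r_k).

    The local functions are glued by taking maxima.  A maximum of functions
    with different domains is plurisubharmonic as soon as each function is
    dominated by the others near the boundary of its own domain
    ([lpsh_glue]).  Two corrections create this domination:

    - g_i gets a small concave bump, larger at a_i than on the sphere bounding
      its domain; a common multiple of |z|^2 restores plurisubharmonicity
      ([bump]);

    - all functions get the logarithmic poles amp_k ln(|z - c_k| / T), except
      that the k-th one is replaced by a constant in the function attached to
      the k-th ball ([pole], [piece]).  The pole makes that function win near
      the boundary of B(c_k, r_k) and lose near that of B(c_k, kappa^4 r_k),
      provided that amp_k ln kappa exceeds the oscillation of [u] there.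

    The separation of the balls guarantees that the other poles are only seen
    from outside their balls B(c_j, r_j), where they cost at most
    amp_j ln(T / r_j).  The total cost is of the order of the sum of
    omega(r_k) ln(1 / r_k), which is the sum of the phi(r_k) and is small
    ([piece_error], [gluing_cost]).

    Two facts of potential theory support the construction.  First, gluing
    only gives the sub-mean value inequality on small circles.  That it then
    holds on all circles is [lpsh_submean], proved by the maximum principle for
    an average of the function over N rotations, as N tends to infinity.
    Second, the approximants given by the hypothesis are merely upper
    semicontinuous and may be very negative off the closure, where the gluing
    compares functions from both sides.  Replacing them by suprema over small
    balls repairs this ([sup_regularisation]). *)

(** * Euclidean norm and topology of C^n *)

Section euclidean_norm.
Context {R : realType}.
Implicit Types (w : CC[R]).

Lemma normc_sqr (w : R[i]) :
  Normc.normc w ^+ 2 = complex.Re w ^+ 2 + complex.Im w ^+ 2.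
Proof. by case: w => a b /=; rewrite sqr_sqrtr// addr_ge0// sqr_ge0. Qed.

Lemma normc_ge0 (w : R[i]) : 0 <= Normc.normc w.
Proof. by case: w => a b /=; rewrite sqrtr_ge0. Qed.

Lemma abs_normc (w : R[i]) : `|w| = (Normc.normc w)%:C%C.
Proof. by []. Qed.

Context {n : nat}.
Implicit Types (z y x a b : CC[R]_n).

Lemma enorm_ge0 z : 0 <= enorm z.
Proof. by rewrite /enorm sqrtr_ge0. Qed.

Lemma enorm_sqr z :
  enorm z ^+ 2 =
  \sum_(j < n) (complex.Re (z ord0 j) ^+ 2 + complex.Im (z ord0 j) ^+ 2).
Proof.
rewrite /enorm sqr_sqrtr; last by apply: sumr_ge0 => j _; rewrite sqr_ge0.
by apply: eq_bigr => j _; rewrite normc_sqr.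
Qed.

(** The real and the imaginary part of the Hermitian product of [z] and [b]. *)
Definition redot z b : R :=
  \sum_(j < n) (complex.Re (z ord0 j) * complex.Re (b ord0 j)
                + complex.Im (z ord0 j) * complex.Im (b ord0 j)).

Definition imdot z b : R :=
  \sum_(j < n) (complex.Im (z ord0 j) * complex.Re (b ord0 j)
                - complex.Re (z ord0 j) * complex.Im (b ord0 j)).

(** On a complex line the squared norm is a quadratic polynomial in two real
    parameters; the Cauchy-Schwarz inequality, the triangle inequality and the
    sub-mean property of the logarithm all come from this formula. *)
Lemma enorm_sqrDZ z b (c s : R) :
  enorm (z + (c +i* s)%C *: b) ^+ 2 =
  enorm z ^+ 2 + 2 * (c * redot z b + s * imdot z b)
  + (c ^+ 2 + s ^+ 2) * enorm b ^+ 2.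
Proof.
rewrite !enorm_sqr /redot /imdot !mulr_sumr -big_split/= mulr_sumr.
rewrite -!big_split/=; apply: eq_bigr => j _; rewrite !mxE.
case: (z ord0 j) => z1 z2; case: (b ord0 j) => b1 b2 /=.
by rewrite /GRing.scale/=; ring.
Qed.

(** A nonnegative quadratic polynomial is nonnegative at its critical point. *)
Lemma dot_CauchySchwarz z b :
  redot z b ^+ 2 + imdot z b ^+ 2 <= enorm z ^+ 2 * enorm b ^+ 2.
Proof.
have H c s : 0 <= enorm z ^+ 2 + 2 * (c * redot z b + s * imdot z b)
  + (c ^+ 2 + s ^+ 2) * enorm b ^+ 2 by rewrite -enorm_sqrDZ sqr_ge0.
move: (redot z b) (imdot z b) (enorm z ^+ 2) (enorm b ^+ 2)
  (sqr_ge0 (enorm z)) (sqr_ge0 (enorm b)) H => P Q N B N0 B0 H.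
have [B00|Bn0] := eqVneq B 0.
  rewrite B00 mulr0 leNgt; apply/negP => S0.
  (* the polynomial is affine here: move far against its gradient *)
  have := H (- (N + 1) / (P ^+ 2 + Q ^+ 2) * P) (- (N + 1) / (P ^+ 2 + Q ^+ 2) * Q).
  have -> : N + 2 * (- (N + 1) / (P ^+ 2 + Q ^+ 2) * P * P
    + - (N + 1) / (P ^+ 2 + Q ^+ 2) * Q * Q) + ((- (N + 1) / (P ^+ 2 + Q ^+ 2) * P) ^+ 2
    + (- (N + 1) / (P ^+ 2 + Q ^+ 2) * Q) ^+ 2) * B = N - 2 * (N + 1).
    by rewrite B00; field; rewrite gt_eqF.
  by lra.
have Bp : 0 < B by rewrite lt_def Bn0.
have := H (- P / B) (- Q / B).
have -> : N + 2 * (- P / B * P + - Q / B * Q)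
   + ((- P / B) ^+ 2 + (- Q / B) ^+ 2) * B = N - (P ^+ 2 + Q ^+ 2) / B by field.
by rewrite subr_ge0 ler_pdivrMr.
Qed.

Lemma enorm0 : enorm (0 : CC[R]_n) = 0.
Proof.
rewrite /enorm big1 ?sqrtr0// => j _.
by rewrite mxE Normc.normc0 expr0n.
Qed.

Lemma enormZ (w : R[i]) z : enorm ((w : CC[R]) *: z) = Normc.normc w * enorm z.
Proof.
apply/eqP; rewrite -(@eqrXn2 _ 2) ?mulr_ge0 ?normc_ge0 ?enorm_ge0// exprMn.
rewrite -[w *: z]add0r; case: w => c s; rewrite enorm_sqrDZ normc_sqr/=.
rewrite enorm0 /redot /imdot !big1 ?mulr0 ?addr0 ?expr0n/= ?add0r//.
- by rewrite mulr0 add0r.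
- by move=> j _; rewrite !mxE !mul0r subr0.
- by move=> j _; rewrite !mxE !mul0r addr0.
Qed.

Lemma enormN z : enorm (- z) = enorm z.
Proof.
rewrite -scaleN1r enormZ -[X in X * _]/(Normc.normc (- 1 : Rcomplex R)) normcN.
by rewrite Normc.normc1 mul1r.
Qed.

Lemma enormBC z y : enorm (z - y) = enorm (y - z).
Proof. by rewrite -enormN opprB. Qed.

Lemma ler_enormD z y : enorm (z + y) <= enorm z + enorm y.
Proof.
rewrite -(@ler_pXn2r _ 2)// ?nnegrE ?addr_ge0 ?enorm_ge0//.
have := dot_CauchySchwarz z y.
have -> : z + y = z + (1 +i* 0)%C *: y by rewrite -[(1 +i* 0)%C]/(1 : CC[R]) scale1r.
rewrite enorm_sqrDZ.
move: (redot z y) (imdot z y) (enorm z) (enorm y) (enorm_ge0 z) (enorm_ge0 y).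
move=> P Q a b a0 b0 H; suff : P <= a * b by nra.
apply: le_trans (ler_norm _) _; rewrite -(@ler_pXn2r _ 2)// ?nnegrE ?mulr_ge0//.
by rewrite exprMn real_normK ?num_real//; nra.
Qed.

Lemma ler_enormB z y x : enorm (z - x) <= enorm (z - y) + enorm (y - x).
Proof. by apply: le_trans (ler_enormD _ _); rewrite addrA subrK. Qed.

Lemma enorm_eq0 z : enorm z = 0 -> z = 0.
Proof.
move=> z0; apply/rowP => j; rewrite mxE; apply: Normc.eq0_normc; apply/eqP.
move/eqP : z0; rewrite /enorm sqrtr_eq0 => s0.
rewrite -sqrf_eq0 eq_le sqr_ge0 andbT; apply: le_trans s0.
by rewrite (bigD1 j)//= lerDl; apply: sumr_ge0 => k _; rewrite sqr_ge0.
Qed.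

Lemma enorm_entry z j : Normc.normc (z ord0 j) <= enorm z.
Proof.
rewrite -(@ler_pXn2r _ 2)// ?nnegrE ?normc_ge0 ?enorm_ge0//.
rewrite enorm_sqr (bigD1 j)//= normc_sqr lerDl.
by apply: sumr_ge0 => k _; rewrite addr_ge0// sqr_ge0.
Qed.

Lemma enorm_lt (z : CC[R]_n) (e : R) : 0 < e ->
  (forall j, Normc.normc (z ord0 j) < e / (n.+1)%:R) -> enorm z < e.
Proof.
move=> e0 H; rewrite -(@ltr_pXn2r _ 2)// ?nnegrE ?enorm_ge0 ?(ltW e0)//.
have m0 : 0 < n.+1%:R :> R by rewrite ltr0n.
apply: (@le_lt_trans _ _ (\sum_(j < n) (e / n.+1%:R) ^+ 2)).
  rewrite /enorm sqr_sqrtr; last by apply: sumr_ge0 => j _; rewrite sqr_ge0.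
  apply: ler_sum => j _; rewrite ler_pXn2r ?nnegrE ?normc_ge0 ?(ltW (H _))//.
  by rewrite divr_ge0// ltW.
rewrite sumr_const card_ord -[X in X < _]mulr_natl exprMn mulrCA.
rewrite gtr_pMr ?exprn_gt0// exprVn ltr_pdivrMr ?exprn_gt0// mul1r -natrX ltr_nat.
by apply: (@leq_trans n.+1) => //; rewrite leq_pmulr.
Qed.

(** The topology of C^n is built from the sup norm of the entries, with radii
    that are positive elements of [R[i]]; Euclidean balls with real radii carry
    all the later arguments. *)
Lemma nbhs_eballP z (U : set CC[R]_n) :
  nbhs z U <-> exists2 r : R, 0 < r & eball z r `<=` U.
Proof.
split.
  move=> /nbhs_ballP[e /= e0 zU].
  have [e1 eE] : exists e1, e = e1%:C%C.
    by case: e e0 {zU} => a b; rewrite ltcE/= => /andP[/eqP-> _]; exists a.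
  move: e0 zU; rewrite {}eE ltcR => e0 zU.
  exists e1 => // y zy; apply: zU; split; first by rewrite ltcR.
  move=> i j.
  rewrite /ball/= ord1 abs_normc ltcR.
  apply: le_lt_trans zy; rewrite -enormBC.
  by apply: le_trans (enorm_entry _ j); rewrite !mxE.
move=> [r r0 zU]; apply/nbhs_ballP.
exists (r / n.+1%:R)%:C%C; first by rewrite /= ltcR divr_gt0// ltr0n.
move=> y zy; apply: zU; apply: enorm_lt => // j.
have := zy.2 ord0 j; rewrite /ball/= abs_normc ltcR.
by rewrite !mxE -[X in _ = true -> X < _]normcN opprB.
Qed.

Lemma nbhs_eball z (r : R) : 0 < r -> nbhs z (eball z r).
Proof. by move=> r0; apply/nbhs_eballP; exists r. Qed.

Lemma eball_open z (r : R) : open (eball z r).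
Proof.
rewrite openE => y zy; apply/nbhs_eballP; exists (r - enorm (y - z)).
  by rewrite subr_gt0.
move=> x; rewrite /eball/= ltrBrDr => H.
by apply: le_lt_trans H; apply: ler_enormB.
Qed.

Lemma enorm_lip z y c : `|enorm (z - c) - enorm (y - c)| <= enorm (z - y).
Proof.
rewrite ler_norml; have := ler_enormB z y c; have := ler_enormB y z c.
by rewrite (enormBC y z); lra.
Qed.

Lemma enorm_continuous c : continuous (fun z => enorm (z - c)).
Proof.
move=> z U /nbhs_ballP[e /= e0 zU]; apply/nbhs_eballP; exists e => // y zy.
by apply: zU; apply: le_lt_trans (enorm_lip _ _ _) _; rewrite enormBC.
Qed.

Lemma closure_eball (S : set CC[R]_n) z :
  closure S z <-> forall r : R, 0 < r -> exists2 y, S y & enorm (y - z) < r.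
Proof.
split => [Sz r r0|H U /nbhs_eballP[r r0 zU]].
  by have [y [Sy zy]] := Sz _ (nbhs_eball z r0); exists y.
by have [y Sy zy] := H r r0; exists y; split => //; apply: zU.
Qed.

(** A closed square of the plane is the continuous image of a product of two
    segments, and a closed bounded set lies in a power of such a square. *)
Lemma bounded_closed_compact (K : set CC[R]_n) (M : R) :
  closed K -> (forall z, K z -> enorm z <= M) -> compact K.
Proof.
move=> Kcl KM.
pose sq : set CC[R] := (fun p : R * R => (p.1 +i* p.2)%C) @`
  (`[- M, M] `*` `[- M, M]).
have csq : compact sq.
  apply: continuous_compact; last first.
    by apply: compact_setX; apply: segment_compact.
  apply: continuous_subspaceT => -[x y].
  apply/cvgrPdist_lt => e /= e0.
  have [e1 eE] : exists e1, e = e1%:C%C.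
    by case: e e0 => a b; rewrite ltcE/= => /andP[/eqP-> _]; exists a.
  move: e0; rewrite {}eE ltcR => e0.
  have e20 : 0 < e1 / 2 by rewrite divr_gt0.
  exists (ball x (e1 / 2), ball y (e1 / 2)) => /=.
    by split; apply: nbhsx_ballx.
  move=> [x' y'] /= [xx' yy']; rewrite abs_normc ltcR.
  rewrite /ball/= in xx' yy'.
  rewrite -(@ltr_pXn2r _ 2)// ?nnegrE ?normc_ge0 ?(ltW e0)// normc_sqr/=.
  rewrite -(real_normK (num_real (x - x'))) -(real_normK (num_real (y - y'))).
  move: xx' yy' (normr_ge0 (x - x')) (normr_ge0 (y - y')).
  by move: (`|x - x'|) (`|y - y'|) => p q; nra.
apply: (@subclosed_compact _ _ [set z : CC[R]_n | forall j, sq (z ord0 j)]) => //.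
  exact: (@rV_compact _ _ (fun=> sq)).
move=> z /KM zM j; have := le_trans (enorm_entry z j) zM.
case: (z ord0 j) => a b ab; exists (a, b) => //=.
have ab2 : a ^+ 2 + b ^+ 2 <= M ^+ 2.
  rewrite -[X in X <= _](@normc_sqr (a +i* b)%C) ler_pXn2r ?nnegrE ?normc_ge0//.
  by apply: le_trans ab; apply: normc_ge0.
have M0 : 0 <= M by apply: le_trans ab; apply: normc_ge0.
by split; rewrite /= in_itv/=; apply/andP; split; nra.
Qed.

End euclidean_norm.

(** * Means over the parameter circle *)

Section circle_mean.
Context {R : realType}.
Implicit Types (f g : R -> R).

Definition circle_integrable g := lebesgue_measure.-integrable `[0, 2 * pi] (EFin \o g).

Definition circle_mean g : R :=
  (2 * pi)^-1 * \int[lebesgue_measure]_(t in `[0, 2 * pi]) g t.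

Lemma twopi_gt0 : 0 < 2 * pi :> R.
Proof. by rewrite mulr_gt0// pi_gt0. Qed.

Lemma compact_bound_above (T : topologicalType) (K : set T) (g : T -> R) :
  compact K -> (forall t, K t -> exists m, \forall s \near t, g s <= m) ->
  exists M, forall t, K t -> g t <= M.
Proof.
move=> /compact_near_coveringP cK H.
have : \forall M \near +oo, K `<=` [set t | g t <= M].
  apply: (cK R +oo (fun M t => g t <= M)) => t Kt.
  have [m gm] := H t Kt.
  exists ([set s | g s <= m], [set M | m <= M]).
    by split => //; apply: nbhs_pinfty_ge; rewrite num_real.
  by move=> [s M] /= [] /le_trans; apply.
case=> M [_ HM]; exists (M + 1) => t Kt; apply: (HM (M + 1)) => //.
by rewrite ltrDl.
Qed.

Lemma compact_bound_below (T : topologicalType) (K : set T) (g : T -> R) :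
  compact K -> (forall t, K t -> exists m, \forall s \near t, m <= g s) ->
  exists M, forall t, K t -> M <= g t.
Proof.
move=> cK H; have [|M HM] := @compact_bound_above _ _ (fun t => - g t) cK.
  move=> t /H[m gm]; exists (- m); near=> s; rewrite lerN2; near: s; exact: gm.
by exists (- M) => t Kt; rewrite lerNl; apply: HM.
Unshelve. all: by end_near. Qed.

Lemma usc_measurable g :
  (forall t a, g t < a -> \forall s \near t, g s < a) ->
  measurable_fun setT g.
Proof.
move=> H.
have lN : lower_semicontinuous (fun t => (- g t)%:E).
  move=> t a; rewrite lte_fin ltrNr => /H gt.
  exists [set s | g s < - a] => // s /=.
  by rewrite lte_fin ltrNr.
have /measurable_realfun.measurable_EFinP mN := measurable_realfun.lower_semicontinuous_measurable lN.
have : measurable_fun setT (fun t => - (- g t)).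
  exact: measurableT_comp.
by congr (measurable_fun _ _); apply/funext => t; rewrite opprK.
Qed.

Lemma bounded_circle_integrable g (m M : R) : measurable_fun setT g ->
  (forall t, t \in `[0, 2 * pi] -> m <= g t <= M) -> circle_integrable g.
Proof.
move=> mg gb; apply: measurable_bounded_integrable => //.
- by rewrite /= lebesgue_measure_itv/=; case: ifPn; rewrite ?ltry.
- exact: measurable_funTS.
- exists (`|m| + `|M|); split; first by rewrite num_real.
  move=> x xM t It /=; have /andP[mg' gM] := gb t It.
  apply: le_trans (ltW xM); rewrite ler_norml.
  have := ler_norm M; have := ler_norm (- m); have := normr_ge0 M.
  have := normr_ge0 m; rewrite normrN; lra.
Qed.

Lemma usc_circle_integrable g :
  (forall t a, g t < a -> \forall s \near t, g s < a) ->
  (forall t : R, exists m, \forall s \near t, m <= g s) -> circle_integrable g.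
Proof.
move=> gusc glb.
have cI : compact `[0, (2 * pi : R)] by exact: segment_compact.
have [|M gM] := @compact_bound_above _ _ g cI.
  move=> t _; exists (g t + 1); have /gusc gt1 : g t < g t + 1 by rewrite ltrDl.
  by near=> s; apply/ltW; near: s.
have [|m gm] := @compact_bound_below _ _ g cI; first by move=> t _; exact: glb.
apply: (@bounded_circle_integrable _ m M); first exact: usc_measurable.
by move=> t It; rewrite gm ?gM.
Unshelve. all: by end_near. Qed.

Lemma continuous_circle_integrable g : continuous g -> circle_integrable g.
Proof.
move=> cg; apply: continuous_compact_integrable; first exact: segment_compact.
exact: continuous_subspaceT.
Qed.

Lemma circle_meanD f g : circle_integrable f -> circle_integrable g ->
  circle_mean (fun t => f t + g t) = circle_mean f + circle_mean g.
Proof. by move=> fi gi; rewrite /circle_mean RintegralD// mulrDr. Qed.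

Lemma circle_integrableD f g : circle_integrable f -> circle_integrable g ->
  circle_integrable (fun t => f t + g t).
Proof. by move=> fi gi; have := integrableD _ fi gi; apply. Qed.

Lemma circle_integrableZ k f : circle_integrable f ->
  circle_integrable (fun t => k * f t).
Proof. by move=> fi; have := integrableZl _ k fi; apply. Qed.

Lemma circle_meanZ k f : circle_integrable f ->
  circle_mean (fun t => k * f t) = k * circle_mean f.
Proof. by move=> fi; rewrite /circle_mean RintegralZl// mulrCA. Qed.

Lemma le_circle_mean f g : circle_integrable f -> circle_integrable g ->
  (forall t, f t <= g t) -> circle_mean f <= circle_mean g.
Proof.
move=> fi gi fg; rewrite /circle_mean ler_pM2l ?invr_gt0 ?twopi_gt0//.
exact: le_Rintegral.
Qed.

Lemma circle_integrable_cst k : circle_integrable (fun=> k).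
Proof. by apply: continuous_circle_integrable => t; apply: cvg_cst. Qed.

Lemma circle_mean_cst k : circle_mean (fun=> k) = k.
Proof.
rewrite /circle_mean Rintegral_cst//= lebesgue_measure_itv/= lte_fin.
rewrite twopi_gt0/= subr0 mulrC -mulrA mulfV ?mulr1// gt_eqF//.
exact: twopi_gt0.
Qed.

(** The derivative of a periodic function has mean zero. *)
Lemma circle_mean_derive f F : continuous f ->
  (forall x : R, is_derive x 1 F (f x)) -> F (2 * pi) = F 0 ->
  circle_mean f = 0.
Proof.
move=> cf Ff Fper; rewrite /circle_mean /Rintegral.
have Fc : continuous F.
  move=> x; apply: differentiable_continuous; apply/derivable1_diffP.
  by have [] := Ff x.
rewrite (@continuous_FTC2 _ f F).
- by rewrite Fper subee//= mulr0.
- exact: twopi_gt0.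
- exact: continuous_subspaceT.
- split.
  + by move=> x _; have [] := Ff x.
  + by apply: cvg_at_right_filter; apply: Fc.
  + by apply: cvg_at_left_filter; apply: Fc.
- by move=> x _; rewrite derive1E; have [_ ->] := Ff x.
Qed.

Lemma circle_mean_cos : circle_mean cos = 0.
Proof.
apply: (circle_mean_derive (@continuous_cos R) (fun=> _)).
by rewrite sin0 mulr_natl sin2pi.
Qed.

End circle_mean.
Section trig.
Context {R : realType}.

Lemma circle_mean_sin : circle_mean (@sin R) = 0.
Proof.
apply: (@circle_mean_derive _ _ (fun t => - cos t) (@continuous_sin R)).
  by move=> x; apply: is_derive_eq; rewrite opprK.
by rewrite cos0 mulr_natl cos2pi.
Qed.

Lemma sin2t_derive (x : R) :
  is_derive x 1 (fun t => sin t * cos t) (cos x ^+ 2 - sin x ^+ 2).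
Proof.
apply: is_derive_eq; rewrite /GRing.scale/=; ring.
Qed.

Lemma cos2t_derive (x : R) :
  is_derive x 1 (fun t => 2^-1 * sin t ^+ 2) (sin x * cos x).
Proof.
apply: is_derive_eq; by rewrite /GRing.scale/=; field.
Qed.

Lemma continuousM2 (f g : R -> R) : continuous f -> continuous g ->
  continuous (fun t => f t * g t).
Proof. by move=> cf cg t; apply: cvgM; [apply: cf|apply: cg]. Qed.

Lemma circle_mean_cos2 : circle_mean (fun t : R => cos t ^+ 2 - sin t ^+ 2) = 0.
Proof.
apply: (@circle_mean_derive _ _ (fun t => sin t * cos t)).
- move=> t; apply: cvgB; apply: continuousM2;
  by [exact: continuous_cos|exact: continuous_sin].
- exact: sin2t_derive.
- by rewrite sin0 mul0r mulr_natl sin2pi mul0r.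
Qed.

Lemma circle_mean_sin2 : circle_mean (fun t : R => sin t * cos t) = 0.
Proof.
apply: (@circle_mean_derive _ _ (fun t => 2^-1 * sin t ^+ 2)).
- apply: continuousM2; by [exact: continuous_cos|exact: continuous_sin].
- exact: cos2t_derive.
- by rewrite sin0 mulr_natl sin2pi.
Qed.

(** Trigonometric polynomials of degree two, with [a2] and [b2] in front of
    cos 2t and (1/2) sin 2t: the test functions on small circles. *)
Definition trig2 (c a1 b1 a2 b2 : R) (t : R) :=
  c + (a1 * cos t + b1 * sin t) +
  (a2 * (cos t ^+ 2 - sin t ^+ 2) + b2 * (sin t * cos t)).

Lemma trig2_mean c a1 b1 a2 b2 :
  circle_integrable (trig2 c a1 b1 a2 b2) /\
  circle_mean (trig2 c a1 b1 a2 b2) = c.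
Proof.
have ci1 : circle_integrable (@cos R).
  by apply: continuous_circle_integrable; exact: continuous_cos.
have ci2 : circle_integrable (@sin R).
  by apply: continuous_circle_integrable; exact: continuous_sin.
have ci3 : circle_integrable (fun t : R => cos t ^+ 2 - sin t ^+ 2).
  apply: continuous_circle_integrable => t; apply: cvgB; apply: continuousM2;
  by [exact: continuous_cos|exact: continuous_sin].
have ci4 : circle_integrable (fun t : R => sin t * cos t).
  apply: continuous_circle_integrable; apply: continuousM2;
  by [exact: continuous_cos|exact: continuous_sin].
have I0 := circle_integrable_cst c.
have I1 := circle_integrableZ a1 ci1.
have I2 := circle_integrableZ b1 ci2.
have I3 := circle_integrableZ a2 ci3.
have I4 := circle_integrableZ b2 ci4.
have I12 := circle_integrableD I1 I2.
have I34 := circle_integrableD I3 I4.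
have I012 := circle_integrableD I0 I12.
split; first exact: circle_integrableD I012 I34.
rewrite /trig2 (circle_meanD I012 I34) (circle_meanD I0 I12).
rewrite (circle_meanD I1 I2) (circle_meanD I3 I4) !circle_meanZ//.
rewrite circle_mean_cst circle_mean_cos circle_mean_sin circle_mean_cos2.
by rewrite circle_mean_sin2 !mulr0 !addr0.
Qed.

End trig.

(** * Local plurisubharmonicity and gluing *)

Section local_psh.
Context {R : realType} {n : nat}.
Implicit Types (z y x b c : CC[R]_n) (f g : CC[R]_n -> R) (O : set CC[R]_n).

(** The circle of radius [rho] around [z] in the complex line of direction
    [b]; letting [b] vary replaces the study of the slices. *)
Definition arc z b (rho t : R) : CC[R]_n := z + circle_pt 0 rho t *: b.

Lemma normc_circle_pt (rho t : R) : Normc.normc (circle_pt 0 rho t) = `|rho|.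
Proof.
rewrite /circle_pt add0r /Normc.normc !exprMn -mulrDr cos2Dsin2 mulr1.
by rewrite sqrtr_sqr.
Qed.

Lemma enorm_arc z b (rho t : R) : enorm (arc z b rho t - z) = `|rho| * enorm b.
Proof. by rewrite /arc addrC addKr enormZ normc_circle_pt. Qed.

Lemma arcE z b (rho t : R) :
  arc z b rho t = z + ((rho * cos t) +i* (rho * sin t))%C *: b.
Proof. by rewrite /arc /circle_pt add0r. Qed.

Lemma enorm_arcB z b (rho t s : R) :
  enorm (arc z b rho s - arc z b rho t) <=
  `|rho| * (`|cos s - cos t| + `|sin s - sin t|) * enorm b.
Proof.
have -> : arc z b rho s - arc z b rho t =
    (circle_pt 0 rho s - circle_pt 0 rho t) *: b.
  by rewrite /arc opprD addrACA subrr add0r scalerBl.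
rewrite enormZ ler_wpM2r ?enorm_ge0// -(@ler_pXn2r _ 2)//.
- rewrite normc_sqr /circle_pt !add0r/= -!mulrBr !exprMn -mulrDr.
  rewrite real_normK ?num_real// ler_wpM2l ?sqr_ge0//.
  rewrite -(real_normK (num_real (cos s - cos t))).
  rewrite -(real_normK (num_real (sin s - sin t))).
  by have := normr_ge0 (cos s - cos t); have := normr_ge0 (sin s - sin t); nra.
- by rewrite nnegrE normc_ge0.
- by rewrite nnegrE mulr_ge0// addr_ge0.
Qed.

Lemma arc_near z b (rho t r : R) : 0 < r ->
  \forall s \near t, eball (arc z b rho t) r (arc z b rho s).
Proof.
move=> r0; pose K := `|rho| * enorm b + 1.
have K0 : 0 < K by rewrite ltr_wpDl// mulr_ge0// enorm_ge0.
have e0 : 0 < r / (2 * K) by rewrite divr_gt0// mulr_gt0.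
near=> s; rewrite /eball/=; apply: le_lt_trans (enorm_arcB _ _ _ _ _) _.
have h1 : `|cos s - cos t| < r / (2 * K).
  rewrite distrC; near: s.
  by apply: (@cvgr_dist_lt _ _ _ (nbhs t)) => //; exact: continuous_cos.
have h2 : `|sin s - sin t| < r / (2 * K).
  rewrite distrC; near: s.
  by apply: (@cvgr_dist_lt _ _ _ (nbhs t)) => //; exact: continuous_sin.
apply: (@le_lt_trans _ _ (K * (`|cos s - cos t| + `|sin s - sin t|))).
  by rewrite mulrAC ler_wpM2r ?addr_ge0// /K lerDl.
have -> : r = K * (r / (2 * K) + r / (2 * K)).
  by field; rewrite gt_eqF.
by rewrite ltr_pM2l// ltrD.
Unshelve. all: by end_near. Qed.

Definition usc_at f z : Prop :=
  forall a, f z < a -> exists2 r : R, 0 < r & forall y, eball z r y -> f y < a.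

Definition bdd_below_at f z : Prop :=
  exists m, exists2 r : R, 0 < r & forall y, eball z r y -> m <= f y.

Definition submean_at f z : Prop :=
  forall b (eta : R), 0 < eta -> exists2 rho0 : R, 0 < rho0 &
    forall rho, 0 < rho < rho0 ->
      f z <= circle_mean (f \o arc z b rho) + eta * rho ^+ 2.

(** A real-valued, local and asymptotic form of plurisubharmonicity: the
    sub-mean value inequality is required on small circles only, up to an error
    o(rho^2) as in the Blaschke-Privalov condition.  It can be checked on an
    expansion of order two, and it passes to sums and to maxima.  The lower
    bound makes the circle means finite. *)
Definition lpsh O f : Prop :=
  forall z, O z -> [/\ usc_at f z, bdd_below_at f z & submean_at f z].

Lemma arc_integrable f z b (rho : R) :
  (forall t, usc_at f (arc z b rho t)) ->
  (forall t, bdd_below_at f (arc z b rho t)) ->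
  circle_integrable (f \o arc z b rho).
Proof.
move=> fu fb; apply: usc_circle_integrable => t.
  by move=> a /= /fu[r r0 fr]; near=> s; apply: fr; near: s; exact: arc_near.
have [m [r r0 fr]] := fb t; exists m.
by near=> s; apply: fr; near: s; exact: arc_near.
Unshelve. all: by end_near. Qed.

Lemma open_eball O z : open O -> O z ->
  exists2 r : R, 0 < r & eball z r `<=` O.
Proof. by rewrite openE => oO /oO /nbhs_eballP. Qed.

Lemma eball_openP O :
  (forall z, O z -> exists2 r : R, 0 < r & eball z r `<=` O) -> open O.
Proof. by move=> H; rewrite openE => z /H ?; apply/nbhs_eballP. Qed.

Lemma small_arc z b (r : R) : 0 < r ->
  exists2 rho0 : R, 0 < rho0 &
    forall rho t, 0 < rho < rho0 -> eball z r (arc z b rho t).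
Proof.
move=> r0; have K0 : 0 < enorm b + 1 by rewrite ltr_wpDl// enorm_ge0.
exists (r / (enorm b + 1)); first by rewrite divr_gt0.
move=> rho t /andP[rho0]; rewrite ltr_pdivlMr// => H.
rewrite /eball/= enorm_arc gtr0_norm//; apply: le_lt_trans H.
by rewrite ler_wpM2l ?(ltW rho0)// lerDl.
Qed.

Lemma lpsh_arc_integrable O f z b : open O -> lpsh O f -> O z ->
  exists2 rho0 : R, 0 < rho0 &
    forall rho, 0 < rho < rho0 -> circle_integrable (f \o arc z b rho) /\
      forall t, O (arc z b rho t).
Proof.
move=> oO fO /(open_eball oO)[r r0 zO].
have [rho0 rho00 H] := small_arc z b r0; exists rho0 => // rho rhoP; split.
  by apply: arc_integrable => t; have [] := fO _ (zO _ (H rho t rhoP)).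
by move=> t; apply: zO; apply: H.
Qed.

Lemma lpsh_sub O U f : U `<=` O -> lpsh O f -> lpsh U f.
Proof. by move=> UO fO z /UO /fO. Qed.

Lemma lpshD O f g : open O -> lpsh O f -> lpsh O g ->
  lpsh O (fun z => f z + g z).
Proof.
move=> oO fO gO z Oz; have [fu [mf [rf rf0 fb]] fs] := fO z Oz.
have [gu [mg [rg rg0 gb]] gs] := gO z Oz; split.
- move=> a fga; have e0 : 0 < (a - (f z + g z)) / 2 by rewrite divr_gt0// subr_gt0.
  have [|r1 r10 H1] := fu (f z + (a - (f z + g z)) / 2); first by rewrite ltrDl.
  have [|r2 r20 H2] := gu (g z + (a - (f z + g z)) / 2); first by rewrite ltrDl.
  exists (Num.min r1 r2); first by rewrite lt_min r10.
  move=> y; rewrite /eball/= lt_min => /andP[/H1 + /H2]; lra.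
- exists (mf + mg); exists (Num.min rf rg); first by rewrite lt_min rf0.
  by move=> y; rewrite /eball/= lt_min => /andP[/fb + /gb]; lra.
- move=> b eta eta0; have e0 : 0 < eta / 2 by rewrite divr_gt0.
  have [r1 r10 H1] := fs b _ e0; have [r2 r20 H2] := gs b _ e0.
  have [r3 r30 H3] := lpsh_arc_integrable b oO fO Oz.
  have [r4 r40 H4] := lpsh_arc_integrable b oO gO Oz.
  exists (Num.min (Num.min r1 r2) (Num.min r3 r4)).
    by rewrite !lt_min r10 r20 r30.
  move=> rho /andP[rho0]; rewrite !lt_min => /andP[/andP[p1 p2] /andP[p3 p4]].
  have [|i3 _] := H3 rho; first by rewrite rho0.
  have [|i4 _] := H4 rho; first by rewrite rho0.
  have := H1 rho; have := H2 rho; rewrite rho0 p1 p2 => /(_ isT) h2 /(_ isT) h1.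
  have -> : (fun z => f z + g z) \o arc z b rho =
    (fun t => (f \o arc z b rho) t + (g \o arc z b rho) t) by [].
  by rewrite circle_meanD//; lra.
Qed.

Lemma lpshZ O f (k : R) : open O -> 0 <= k -> lpsh O f ->
  lpsh O (fun z => k * f z).
Proof.
move=> oO; rewrite le_eqVlt => /predU1P[<- _ z Oz|k0 fO z Oz].
  split.
  - by move=> a; rewrite mul0r => a0; exists 1 => // y _; rewrite mul0r.
  - by exists 0; exists 1 => // y _; rewrite mul0r.
  - move=> b eta eta0; exists 1 => // rho /andP[rho0 _].
    have -> : (fun z => 0 * f z) \o arc z b rho = fun=> 0.
      by apply/funext => t /=; rewrite mul0r.
    by rewrite circle_mean_cst mul0r add0r mulr_ge0 ?sqr_ge0// ltW.
have [fu [mf [rf rf0 fb]] fs] := fO z Oz; split.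
- move=> a; rewrite mulrC -ltr_pdivlMr// => /fu[r r0 H]; exists r => // y /H.
  by rewrite ltr_pdivlMr// mulrC.
- by exists (k * mf); exists rf => // y /fb; rewrite ler_pM2l.
- move=> b eta eta0; have e0 : 0 < eta / k by rewrite divr_gt0.
  have [r1 r10 H1] := fs b _ e0.
  have [r3 r30 H3] := lpsh_arc_integrable b oO fO Oz.
  exists (Num.min r1 r3); first by rewrite lt_min r10.
  move=> rho /andP[rho0]; rewrite !lt_min => /andP[p1 p3].
  have [|i3 _] := H3 rho; first by rewrite rho0.
  have := H1 rho; rewrite rho0 p1 => /(_ isT) h1.
  have -> : (fun z => k * f z) \o arc z b rho =
    (fun t => k * (f \o arc z b rho) t) by [].
  rewrite circle_meanZ//.
  have -> : eta = k * (eta / k) by field; rewrite gt_eqF.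
  by rewrite -mulrA -mulrDr ler_pM2l.
Qed.

Lemma lpsh_cst O (k : R) : lpsh O (fun=> k).
Proof.
move=> z _; split.
- by move=> a ka; exists 1.
- by exists k; exists 1.
- move=> b eta eta0; exists 1 => // rho /andP[rho0 _].
  have -> : (fun=> k) \o arc z b rho = fun=> k by [].
  by rewrite circle_mean_cst lerDl mulr_ge0 ?sqr_ge0// ltW.
Qed.

Lemma lpsh_sum (J : eqType) (s : seq J) (P : pred J) (F : J -> CC[R]_n -> R) O :
  open O -> (forall j, P j -> lpsh O (F j)) ->
  lpsh O (fun z => \sum_(j <- s | P j) F j z).
Proof.
move=> oO FO; elim: s => [|j s IH].
  have -> : (fun z => \sum_(j <- [::] | P j) F j z) = fun=> 0.
    by apply/funext => z; rewrite big_nil.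
  exact: lpsh_cst.
case Pj : (P j); last first.
  have -> : (fun z => \sum_(j0 <- j :: s | P j0) F j0 z) =
      fun z => \sum_(j0 <- s | P j0) F j0 z.
    by apply/funext => z; rewrite big_cons Pj.
  exact: IH.
have -> : (fun z => \sum_(j0 <- j :: s | P j0) F j0 z) =
    fun z => F j z + \sum_(j0 <- s | P j0) F j0 z.
  by apply/funext => z; rewrite big_cons Pj.
by apply: lpshD => //; apply: FO.
Qed.

Definition cont_at f z : Prop :=
  forall e, 0 < e ->
    exists2 r : R, 0 < r & forall y, eball z r y -> `|f y - f z| < e.

(** All terms of a trigonometric minorant except the constant one have mean
    zero. *)
Lemma trig_submean O f z : open O -> O z ->
  (forall x, O x -> cont_at f x) ->
  (forall b (eta : R), 0 < eta -> exists2 rho0 : R, 0 < rho0 &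
    forall rho, 0 < rho < rho0 -> exists a1 c1 a2 c2 : R, forall t : R,
      trig2 (f z - eta * rho ^+ 2) a1 c1 a2 c2 t <= f (arc z b rho t)) ->
  [/\ usc_at f z, bdd_below_at f z & submean_at f z].
Proof.
move=> oO Oz fc H.
have fu x : O x -> usc_at f x.
  move=> Ox a fa; have [|r r0 fr] := fc x Ox (a - f x); first by rewrite subr_gt0.
  by exists r => // y /fr; rewrite ltr_norml; lra.
have fb x : O x -> bdd_below_at f x.
  move=> Ox; have [//|r r0 fr] := fc x Ox 1; exists (f x - 1); exists r => // y.
  by move=> /fr; rewrite ltr_norml; lra.
split; [exact: fu|exact: fb|move=> b eta eta0].
have [rho0 rho00 {}H] := H b eta eta0.
have [r r0 zO] := open_eball oO Oz.
have [rho1 rho10 H1] := small_arc z b r0.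
exists (Num.min rho0 rho1); first by rewrite lt_min rho00.
move=> rho /andP[rhop]; rewrite lt_min => /andP[r2 r3].
have [|a1 [c1 [a2 [c2 Ht]]]] := H rho; first by rewrite rhop.
have [i m] := trig2_mean (f z - eta * rho ^+ 2) a1 c1 a2 c2.
rewrite -lerBlDr -m; apply: le_circle_mean => //.
by apply: arc_integrable => t; [apply: fu|apply: fb];
  apply: zO; apply: H1; rewrite rhop.
Qed.

Lemma fin_radius (I : finType) (P : I -> R -> Prop) :
  (forall i r r', 0 < r' -> r' <= r -> P i r -> P i r') ->
  (forall i, exists2 r : R, 0 < r & P i r) ->
  exists2 r : R, 0 < r & forall i, P i r.
Proof.
move=> Pmono Pex.
have /choice[r Pr] : forall i, exists r, 0 < r /\ P i r.
  by move=> i; have [r] := Pex i; exists r.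
have rb i : \big[Num.min/1]_(j : I) r j <= r i by apply: bigmin_le_cond.
have r0 : 0 < \big[Num.min/1]_(j : I) r j.
  by apply: lt_bigmin => // i _; have [] := Pr i.
exists (\big[Num.min/1]_(j : I) r j) => // i.
by have [_ Pri] := Pr i; apply: Pmono Pri.
Qed.

(** Near a point x of [X] the pieces whose domain misses x are dominated, so
    the maximum over all pieces is the maximum over the fixed finite set of
    pieces whose domain contains x. *)
Lemma lpsh_glue (I : finType) (O : I -> set CC[R]_n) (f : I -> CC[R]_n -> R)
    (X : set CC[R]_n) :
  (forall i, open (O i)) -> (forall i, lpsh (O i) (f i)) ->
  (forall x, X x -> exists k, O k x) ->
  (forall x i, X x -> ~ O i x -> exists2 r : R, 0 < r &
    forall y, eball x r y -> O i y -> exists k, O k x /\ f i y <= f k y) ->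
  exists W w, [/\ open W, X `<=` W, lpsh W w &
    forall x, X x -> exists2 i, O i x & w x = f i x].
Proof.
move=> oO fO Xcov Xdom.
have [w wP] : exists w : CC[R]_n -> R, forall y, (exists i, O i y) ->
    (forall i, O i y -> f i y <= w y) /\ exists2 i, O i y & w y = f i y.
  suff /choice[w wP] : forall y, exists a, (exists i, O i y) ->
    (forall i, O i y -> f i y <= a) /\ exists2 i, O i y & a = f i y by exists w.
  move=> y; have [[i0 Oi0]|no] := pselect (exists i, O i y); last by exists 0.
  case: (@arg_maxP _ _ _ i0 (fun i => `[< O i y >]) (f^~ y)); first exact/asboolP.
  move=> i /asboolP Oi imax; exists (f i y) => _; split; last by exists i.
  by move=> j Oj; apply: imax; apply/asboolP.
pose good x r := forall y, eball x r y -> forall i,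
  (O i x -> O i y) /\ (O i y -> exists k, O k x /\ f i y <= f k y).
have good_ex x : X x -> exists2 r : R, 0 < r & good x r.
  move=> Xx.
  have [||r r0 H] := @fin_radius I (fun i r => forall y, eball x r y ->
    (O i x -> O i y) /\ (O i y -> exists k, O k x /\ f i y <= f k y)).
  - by move=> i r r' _ r'r H y yr; apply: H; apply: lt_le_trans r'r.
  - move=> i; have [Oix|nOix] := pselect (O i x).
      have [r r0 rO] := open_eball (oO i) Oix; exists r => // y /rO Oiy.
      by split=> // _; exists i.
    have [r r0 H] := Xdom x i Xx nOix.
    by exists r => // y yr; split => // Oiy; apply: H.
  - by exists r => // y yr i; apply: H.
pose W : set CC[R]_n := [set y | exists x, X x /\
  exists2 r : R, good x r & eball x r y].
exists W, w.
have oW : open W.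
  apply: eball_openP => y [x [Xx [r gr yr]]].
  have [s s0 sH] := open_eball (@eball_open _ _ x r) yr.
  by exists s => // y' /sH y'r; exists x; split => //; exists r.
have XW : X `<=` W.
  move=> x Xx; have [r r0 gr] := good_ex x Xx; exists x; split => //.
  by exists r => //; rewrite /eball/= subrr enorm0.
(* on a good ball the maximum is taken over the indices active at its centre *)
have wE x r y : X x -> good x r -> eball x r y ->
    (forall k, O k x -> f k y <= w y) /\ exists k, O k x /\ w y = f k y.
  move=> Xx gr yr.
  have [k0 Ok0] := Xcov x Xx.
  have [|wmax [i Oi wi]] := wP y; first by exists k0; apply/(gr y yr k0).1.
  split; first by move=> k Ok; apply: wmax; apply/(gr y yr k).1.
  have [k [Ok ik]] := (gr y yr i).2 Oi; exists k; split => //.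
  by apply/eqP; rewrite eq_le {1}wi ik/=; apply: wmax; apply/(gr y yr k).1.
have wuc z : W z -> usc_at w z.
  move=> [x [Xx [r gr zr]]] a wza.
  have [||s s0 H] := @fin_radius I (fun k s => O k x -> forall y,
      eball z s y -> f k y < a).
  - by move=> i s s' _ s's H Oi y ys; apply: H => //; apply: lt_le_trans s's.
  - move=> k; have [Okx|] := pselect (O k x); last by exists 1.
    have Okz : O k z by apply/(gr z zr k).1.
    have [+ _ _] := fO k z Okz => /(_ a) [|s s0 fs]; last by exists s.
    by apply: le_lt_trans wza; apply: (wE x r z Xx gr zr).1.
  have [s' s'0 s'H] := open_eball (@eball_open _ _ x r) zr.
  exists (Num.min s s'); first by rewrite lt_min s0.
  move=> y; rewrite /eball/= lt_min => /andP[ys ys'].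
  have [_ [k [Ok ->]]] := wE x r y Xx gr (s'H _ ys').
  exact: H.
have wbd z : W z -> bdd_below_at w z.
  move=> [x [Xx [r gr zr]]].
  have [k Ok] := Xcov x Xx; have Okz : O k z by apply/(gr z zr k).1.
  have [_ [m [s s0 fs]] _] := fO k z Okz.
  have [s' s'0 s'H] := open_eball (@eball_open _ _ x r) zr.
  exists m; exists (Num.min s s'); first by rewrite lt_min s0.
  move=> y; rewrite /eball/= lt_min => /andP[ys ys'].
  apply: le_trans (fs y ys) _.
  by apply: (wE x r y Xx gr (s'H _ ys')).1.
split => //.
- move=> z Wz; split; [exact: wuc|exact: wbd|].
  have [x [Xx [r gr zr]]] := Wz.
  have [_ [k [Okx wk]]] := wE x r z Xx gr zr.
  have Okz : O k z by apply/(gr z zr k).1.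
  move=> b eta eta0; have [_ _ /(_ b eta eta0)[r1 r10 H1]] := fO k z Okz.
  have [r2 r20 H2] := lpsh_arc_integrable b (oO k) (fO k) Okz.
  have [s' s'0 s'H] := open_eball (@eball_open _ _ x r) zr.
  have [r3 r30 H3] := small_arc z b s'0.
  exists (Num.min r1 (Num.min r2 r3)); first by rewrite !lt_min r10 r20.
  move=> rho /andP[rho0]; rewrite !lt_min => /andP[p1 /andP[p2 p3]].
  have A t : eball x r (arc z b rho t) by apply: s'H; apply: H3; rewrite rho0.
  have [|i2 _] := H2 rho; first by rewrite rho0.
  rewrite wk; apply: (@le_trans _ _ (circle_mean (f k \o arc z b rho) + eta * rho ^+ 2)).
    by apply: H1; rewrite rho0.
  rewrite lerD2r; apply: le_circle_mean => //.
    by apply: arc_integrable => t; [apply: wuc|apply: wbd]; exists x; split => //;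
      exists r.
  by move=> t; apply: (wE x r _ Xx gr (A t)).1.
- move=> x Xx; have [|_] := wP x; first exact: Xcov.
  by [].
Qed.

End local_psh.

(** * Quadratic functions and logarithmic poles *)

Section logarithm.
Context {R : realType}.

(** The function ln y - (y - 1) + (y - 1)^2 / 2 vanishes at 1 and has the
    derivative (y - 1)^2 / y; the mean value theorem bounds it from below. *)
Lemma ln_ge_cubic (x : R) : `|x| <= 2^-1 ->
  x - x ^+ 2 / 2 - 2 * `|x| ^+ 3 <= ln (1 + x).
Proof.
rewrite ler_norml => /andP[x1 x2].
pose F (y : R) := ln y - ((y - 1) - 2^-1 * (y - 1) ^+ 2).
pose dF (y : R) := (y - 1) ^+ 2 / y.
have dFP (y : R) : 0 < y -> is_derive y 1 F (dF y).
  move=> y0; have dln := is_derive1_ln y0.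
  apply: is_derive_eq; rewrite /dF /GRing.scale/=.
  by field; rewrite gt_eqF.
have Fc (a b : R) : 0 < a -> {within `[a, b], continuous F}.
  move=> a0; apply: continuous_in_subspaceT => y; rewrite inE/= in_itv/=.
  move=> /andP[ay _]; apply: differentiable_continuous.
  by apply/derivable1_diffP; have [] := dFP y (lt_le_trans a0 ay).
have F1 : F 1 = 0 by rewrite /F ln1 subrr expr0n/= mulr0 !subr0.
have [x0|x0] := leP 0 x.
  have [|||c c1] := @MVT_segment _ F dF 1 (1 + x); rewrite ?lerDl//.
  - move=> y; rewrite in_itv/= => /andP[y0 _]; apply: dFP.
    by apply: lt_trans y0.
  - exact: Fc.
  have E : 1 + x - 1 = x by ring.
  rewrite F1 subr0 /F !E => FE.
  have : 0 <= dF c * x.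
    rewrite mulr_ge0// /dF divr_ge0 ?sqr_ge0//.
    by move: c1; rewrite in_itv/= => /andP[c1 _]; apply: le_trans c1.
  by rewrite -FE ger0_norm//; have := exprn_ge0 3 x0; lra.
have p1 : 0 < 1 + x by lra.
have [|||c c1] := @MVT_segment _ F dF (1 + x) 1; first lra.
- move=> y; rewrite in_itv/= => /andP[y0 _]; apply: dFP.
  exact: lt_trans y0.
- exact: Fc.
have E : 1 + x - 1 = x by ring.
rewrite F1 sub0r /F !E => FE.
move: c1; rewrite in_itv/= => /andP[c1 c2].
have c0 : 0 < c by lra.
have dc : dF c <= 2 * x ^+ 2.
  by rewrite /dF ler_pdivrMr//; nra.
have : dF c * (1 - (1 + x)) <= 2 * x ^+ 2 * (1 - (1 + x)).
  by rewrite ler_wpM2r//; lra.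
rewrite -FE ltr0_norm//.
have -> : (- x) ^+ 3 = x ^+ 2 * - x by ring.
by lra.
Qed.

Context {n : nat}.
Implicit Types (z c : CC[R]_n).

Lemma cont_at_continuous (f : CC[R]_n -> R) z :
  {for z, continuous f} -> cont_at f z.
Proof.
move=> fc e e0; have /nbhs_eballP[r r0 H] := fc _ (nbhsx_ballx (f z) e e0).
by exists r => // y /H; rewrite /ball/= distrC.
Qed.

Lemma cont_at_comp (g : R -> R) (f : CC[R]_n -> R) z :
  continuous g -> cont_at f z -> cont_at (fun y => g (f y)) z.
Proof.
move=> cg fz e e0; have /nbhs_ballP[d d0 H] := cg (f z) _ (nbhsx_ballx _ e e0).
have [r r0 rH] := fz d d0; exists r => // y /rH fy.
by rewrite distrC; apply: H; rewrite /ball/= distrC.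
Qed.

Lemma cont_atD (f g : CC[R]_n -> R) z : cont_at f z -> cont_at g z ->
  cont_at (fun y => f y + g y) z.
Proof.
move=> fz gz e e0; have e20 : 0 < e / 2 by rewrite divr_gt0.
have [r r0 rH] := fz _ e20; have [s s0 sH] := gz _ e20.
exists (Num.min r s); first by rewrite lt_min r0.
move=> y; rewrite /eball/= lt_min => /andP[/rH + /sH].
by rewrite !ltr_norml; lra.
Qed.

Lemma cont_at_enormB c z : cont_at (fun y => enorm (y - c)) z.
Proof. by apply: cont_at_continuous; apply: enorm_continuous. Qed.

Lemma continuous_sqr (k : R) : continuous (fun x : R => k * x ^+ 2).
Proof.
by move=> x; apply: cvgM; [exact: cvg_cst|exact: exprn_continuous].
Qed.

(** On a circle of radius rho in direction [b] the mean exceeds the value at the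
    centre by (A - B) rho^2 |b|^2. *)
Lemma lpsh_quad (O : set CC[R]_n) (a : CC[R]_n) (A B : R) : open O -> B <= A ->
  lpsh O (fun z => A * enorm z ^+ 2 - B * enorm (z - a) ^+ 2).
Proof.
move=> oO BA z Oz; apply: trig_submean oO Oz _ _.
  move=> x _.
  have -> : (fun z => A * enorm z ^+ 2 - B * enorm (z - a) ^+ 2) =
     fun z => A * enorm (z - 0) ^+ 2 + (- B) * enorm (z - a) ^+ 2.
    by apply/funext => y; rewrite subr0 mulNr.
  by apply: cont_atD; [apply: (cont_at_comp (@continuous_sqr A))|
    apply: (cont_at_comp (@continuous_sqr (- B)))]; apply: cont_at_enormB.
move=> b eta eta0; exists 1 => // rho /andP[rho0 _].
exists (2 * rho * (A * redot z b - B * redot (z - a) b)).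
exists (2 * rho * (A * imdot z b - B * imdot (z - a) b)); exists 0, 0 => t.
rewrite /trig2 arcE (addrAC z _ (- a)) !enorm_sqrDZ.
have := sqr_ge0 (enorm b); move: (enorm b ^+ 2) => N N0.
rewrite -[leLHS]addr0.
have -> : (rho * cos t) ^+ 2 + (rho * sin t) ^+ 2 = rho ^+ 2.
  by rewrite !exprMn -mulrDr cos2Dsin2 mulr1.
have h1 : 0 <= eta * rho ^+ 2 by rewrite mulr_ge0 ?sqr_ge0// ltW.
have h2 : 0 <= (A - B) * (rho ^+ 2 * N).
  by rewrite mulr_ge0 ?subr_ge0// mulr_ge0// sqr_ge0.
by lra.
Qed.

Lemma open_setC1 c : open (~` [set c]).
Proof.
apply: eball_openP => z /= zc; exists (enorm (z - c)).
  rewrite lt_def enorm_ge0 andbT; apply/negP => /eqP /enorm_eq0 /eqP.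
  by rewrite subr_eq0 => /eqP.
by move=> y; rewrite /eball/= => + yc; rewrite yc enormBC ltxx.
Qed.

Lemma enorm_gt0 z c : z <> c -> 0 < enorm (z - c).
Proof.
move=> zc; rewrite lt_def enorm_ge0 andbT; apply/negP => /eqP /enorm_eq0 /eqP.
by rewrite subr_eq0 => /eqP.
Qed.

(** Write p + iq for the Hermitian product of z - c and [b], and d for |b|^2,
    both divided by |z - c|^2.  The expansion of the logarithm to order two
    has mean rho^2 (d - p^2 - q^2) / 2 over the value at the centre, which is
    nonnegative by the Cauchy-Schwarz inequality. *)
Lemma lpsh_ln c : lpsh (~` [set c]) (fun z => ln (enorm (z - c))).
Proof.
move=> z zc; have := @trig_submean R n _ (fun y => ln (enorm (y - c))) z (@open_setC1 c) zc; apply.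
  move=> x /= xc; apply: cont_at_continuous.
  apply: (@continuous_comp _ _ _ (fun z => enorm (z - c)) (@ln R)).
    exact: enorm_continuous.
  by apply: continuous_ln; apply: enorm_gt0.
move=> b eta eta0.
have e0 := enorm_gt0 zc; have N0 : 0 < enorm (z - c) ^+ 2 by rewrite exprn_gt0.
set N := enorm (z - c) ^+ 2; set P := redot (z - c) b; set Q := imdot (z - c) b.
set B := enorm b ^+ 2.
have B0 : 0 <= B by rewrite sqr_ge0.
have PQ : P ^+ 2 + Q ^+ 2 <= N * B by exact: dot_CauchySchwarz.
pose p := P / N; pose q := Q / N; pose d := B / N.
have d0 : 0 <= d by rewrite divr_ge0// ltW.
have pqd : p ^+ 2 + q ^+ 2 <= d.
  rewrite /p /q /d !expr_div_n -mulrDl ler_pdivrMr ?exprn_gt0//.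
  suff -> : B / N * N ^+ 2 = N * B by [].
  by field; rewrite gt_eqF.
have PE : P = N * p by rewrite /p; field; rewrite gt_eqF.
have QE : Q = N * q by rewrite /q; field; rewrite gt_eqF.
have BE : B = N * d by rewrite /d; field; rewrite gt_eqF.
clearbody p q d.
pose K := 2 * (`|p| + `|q|) + d.
have K0 : 0 <= K by rewrite addr_ge0// mulr_ge0// addr_ge0.
pose K' := 2 * K ^+ 2 + 2 * K ^+ 3.
have K'0 : 0 <= K' by rewrite addr_ge0// mulr_ge0// exprn_ge0.
exists (Num.min 1 (Num.min (2^-1 / (K + 1)) (2 * eta / (K' + 1)))).
  by rewrite !lt_min ltr01 !divr_gt0// ?ltr_wpDl// mulr_gt0.
move=> rho /andP[rho0]; rewrite !lt_min => /andP[rho1 /andP[rhoK rhoK']].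
exists (rho * p), (rho * q), (- (rho ^+ 2 / 2 * (p ^+ 2 - q ^+ 2))).
exists (- (rho ^+ 2 * 2 * p * q)) => t.
rewrite /trig2 arcE (addrAC z _ (- c)).
set v := z - c + _ *: b; set e := enorm (z - c).
have [C1 S1] := (cos_max t, sin_max t).
have sc := cos2Dsin2 t.
pose x := rho * (2 * (p * cos t + q * sin t)) + rho ^+ 2 * d.
have vE : enorm v ^+ 2 = N * (1 + x).
  rewrite /v enorm_sqrDZ -/N -/P -/Q -/B !exprMn -mulrDr sc mulr1 /x.
  by rewrite PE QE BE; ring.
have xK : `|x| <= rho * K.
  rewrite /x; apply: le_trans (ler_normD _ _) _.
  rewrite !normrM (gtr0_norm rho0) (ger0_norm d0) normr_nat.
  have h1 : `|p * cos t + q * sin t| <= `|p| + `|q|.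
    apply: le_trans (ler_normD _ _) _; rewrite !normrM.
    by apply: lerD; apply: ler_piMr.
  have h2 : rho * rho * d <= rho * d.
    by rewrite ler_wpM2r// ler_piMr// ltW.
  have := ler_wpM2l (ltW rho0) h1.
  by rewrite /K; lra.
have x2 : `|x| <= 2^-1.
  apply: le_trans xK _; move: rhoK; rewrite ltr_pdivlMr ?ltr_wpDl//.
  by move: (ltW rho0); lra.
have v0 : 0 < enorm v.
  rewrite lt_def enorm_ge0 andbT; apply/negP => /eqP ve.
  have : N * (1 + x) = 0 by rewrite -vE ve expr0n.
  move/eqP; rewrite mulf_eq0 gt_eqF//= => /eqP.
  by move: x2; rewrite ler_norml; lra.
have lnv : ln (enorm v) = ln e + 2^-1 * ln (1 + x).
  have x1 : 0 < 1 + x by move: x2; rewrite ler_norml; lra.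
  have : ln (enorm v ^+ 2) = ln N + ln (1 + x).
    by rewrite vE lnM// posrE.
  rewrite /N !lnXn// -/e => h; lra.
have L := ln_ge_cubic x2.
have x3 : `|x| ^+ 3 <= rho ^+ 3 * K ^+ 3.
  rewrite -exprMn; apply: lerXn2r => //; rewrite nnegrE ?mulr_ge0 ?(ltW rho0)//.
set X := p * cos t + q * sin t in x xK x2 L vE x3 lnv *.
have XK : 2 * `|X| <= K.
  rewrite /K -[leLHS]addr0 lerD// ler_pM2l//.
  apply: le_trans (ler_normD _ _) _; rewrite !normrM.
  by apply: lerD; apply: ler_piMr.
have dK : d <= K by rewrite /K lerDr mulr_ge0// addr_ge0.
have r3 : 0 <= rho ^+ 3 by rewrite exprn_ge0// ltW.
have r4 : rho ^+ 4 <= rho ^+ 3.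
  by rewrite exprS ler_piMl// ltW.
have m0 : rho ^+ 2 * (p ^+ 2 + q ^+ 2) <= rho ^+ 2 * d.
  by rewrite ler_wpM2l ?sqr_ge0.
have m1 : rho ^+ 3 * (2 * X * d) <= rho ^+ 3 * K ^+ 2.
  rewrite ler_wpM2l// expr2; apply: le_trans (ler_norm _) _.
  by rewrite !normrM (ger0_norm d0) ger0_norm// ler_pM// mulr_ge0.
have m2 : rho ^+ 4 * d ^+ 2 <= rho ^+ 3 * K ^+ 2.
  by rewrite ler_pM ?sqr_ge0 ?exprn_ge0 ?(ltW rho0)// ler_pXn2r.
have m3 : rho ^+ 3 * K' <= 2 * eta * rho ^+ 2.
  move: rhoK'; rewrite ltr_pdivlMr ?ltr_wpDl// => /ltW h.
  have : rho ^+ 2 * (rho * (K' + 1)) <= rho ^+ 2 * (2 * eta).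
    by rewrite ler_wpM2l ?sqr_ge0.
  rewrite mulrDr mulr1 mulrDr mulrA => h3.
  have h4 : 0 <= rho ^+ 2 * rho by rewrite mulr_ge0 ?sqr_ge0// ltW.
  by move: h3 h4; rewrite -exprSr; lra.
have X2 : 2 * X ^+ 2 = p ^+ 2 + q ^+ 2 + (p ^+ 2 - q ^+ 2) *
    (cos t ^+ 2 - sin t ^+ 2) + 4 * p * q * (sin t * cos t).
  have hp : p ^+ 2 * (cos t ^+ 2 + sin t ^+ 2) = p ^+ 2 by rewrite sc mulr1.
  have hq : q ^+ 2 * (cos t ^+ 2 + sin t ^+ 2) = q ^+ 2 by rewrite sc mulr1.
  by rewrite /X; lra.
have X2r : rho ^+ 2 * (2 * X ^+ 2) = rho ^+ 2 * (p ^+ 2 + q ^+ 2 + (p ^+ 2 - q ^+ 2) *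
    (cos t ^+ 2 - sin t ^+ 2) + 4 * p * q * (sin t * cos t)) by rewrite X2.
have XE : rho * X = rho * (p * cos t + q * sin t) by [].
have xE : x - x ^+ 2 / 2 = 2 * (rho * X) + rho ^+ 2 * d - rho ^+ 2 * (2 * X ^+ 2)
    - rho ^+ 3 * (2 * X * d) - rho ^+ 4 * d ^+ 2 / 2.
  by rewrite /x; field.
rewrite lnv; move: L m3 x3; rewrite xE X2r XE /K'.
move: (ln (1 + x)) (`|x| ^+ 3) => Lx x3.
have m4 : 0 <= rho ^+ 3 * K ^+ 2 by rewrite mulr_ge0// sqr_ge0.
clear -m0 m1 m2 m4.
lra.
Qed.
End logarithm.

(** * Maxima, polar coordinates and finite sums of means *)

Section rotations.
Context {R : realType}.

(** Otherwise each point has a neighbourhood where [g] stays below a level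
    smaller than the supremum, and by compactness one level serves everywhere. *)
Lemma usc_attains_max (T : topologicalType) (K : set T) (g : T -> R) :
  compact K -> K !=set0 ->
  (forall x, K x -> forall a, g x < a -> \forall y \near x, g y < a) ->
  exists2 x, K x & forall y, K y -> g y <= g x.
Proof.
move=> cK [x0 Kx0] gusc.
have [|M gM] := @compact_bound_above _ _ K g cK.
  move=> t Kt; exists (g t + 1).
  have /(gusc t Kt) gt1 : g t < g t + 1 by rewrite ltrDl.
  by near=> s; apply/ltW; near: s.
have sP : has_sup (g @` K).
  by split; [exists (g x0); exists x0|exists M => _ [y Ky <-]; apply: gM].
pose s := sup (g @` K).
have gs y : K y -> g y <= s by move=> Ky; apply: sup_upper_bound => //; exists y.
have [[x Kx gx]|no] := pselect (exists2 x, K x & g x = s).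
  by exists x => // y /gs; rewrite gx.
have lts x : K x -> g x < s.
  by move=> Kx; rewrite lt_neqAle gs// andbT; apply/eqP => gx; apply: no; exists x.
move/compact_near_coveringP : cK => cK.
have : \forall a \near s^'-, K `<=` [set y | g y < a].
  apply: (cK R s^'- (fun a y => g y < a)) => x Kx.
  have m1 : g x < (g x + s) / 2 by have := lts x Kx; lra.
  have m2 : (g x + s) / 2 < s by have := lts x Kx; lra.
  exists ([set y | g y < (g x + s) / 2], [set a | (g x + s) / 2 < a]).
    by split; [exact: gusc|exact: nbhs_left_gt].
  by move=> [y a] /= [] /lt_trans; apply.
move=> H; have [a [as_ Ka]] : exists a, a < s /\ K `<=` [set y | g y < a].
  near (s^'-) => a; exists a; split; first by near: a; exact: nbhs_left_lt.
  by near: a.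
have : s <= a.
  apply: sup_le_ub; first by exists (g x0), x0.
  by move=> _ [y /Ka/ltW + <-].
by rewrite leNgt as_.
Unshelve. all: by end_near. Qed.

Lemma polar (x y : R) : exists s theta : R,
  [/\ 0 <= s, 0 <= theta <= 2 * pi, x = s * cos theta & y = s * sin theta].
Proof.
have [|n0] := eqVneq (x ^+ 2 + y ^+ 2) 0.
  move=> /eqP; rewrite paddr_eq0 ?sqr_ge0// !sqrf_eq0 => /andP[/eqP-> /eqP->].
  by exists 0, 0; rewrite !mul0r lexx mulr_ge0// pi_ge0.
have p0 : 0 < x ^+ 2 + y ^+ 2 by rewrite lt_def n0 addr_ge0// sqr_ge0.
pose s := Num.sqrt (x ^+ 2 + y ^+ 2).
have s0 : 0 < s by rewrite sqrtr_gt0.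
have s2 : s ^+ 2 = x ^+ 2 + y ^+ 2 by rewrite sqr_sqrtr// ltW.
have xs : -1 <= x / s <= 1.
  by rewrite -ler_norml normrM normfV (gtr0_norm s0) ler_pdivrMr// mul1r
    -(@ler_pXn2r _ 2) ?nnegrE ?normr_ge0 ?(ltW s0)// real_normK ?num_real// s2
    lerDl sqr_ge0.
have sE : sin (acos (x / s)) = `|y| / s.
  rewrite sin_acos//.
  have -> : 1 - (x / s) ^+ 2 = (`|y| / s) ^+ 2.
    rewrite expr_div_n (expr_div_n `|y|) real_normK ?num_real//.
    have -> : y ^+ 2 = s ^+ 2 - x ^+ 2 by rewrite s2; ring.
    by field; rewrite gt_eqF.
  by rewrite sqrtr_sqr ger0_norm// divr_ge0// ltW.
have a0 := acos_ge0 xs; have api := acos_lepi xs.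
have pp := @pi_gt0 R.
have [y0|y0] := leP 0 y.
  exists s, (acos (x / s)); split => //; first exact: ltW.
  - by rewrite a0/=; lra.
  - by rewrite acosK ?in_itv// mulrC divfK// gt_eqF.
  - by rewrite sE ger0_norm// mulrC divfK// gt_eqF.
exists s, (2 * pi - acos (x / s)); split => //; first exact: ltW.
- by apply/andP; split; lra.
- have -> : 2 * pi - acos (x / s) = - acos (x / s) + pi *+ 2.
    by rewrite mulr_natl addrC.
  by rewrite cosD2pi cosN acosK ?in_itv// mulrC divfK// gt_eqF.
- have -> : 2 * pi - acos (x / s) = - acos (x / s) + pi *+ 2.
    by rewrite mulr_natl addrC.
  rewrite sinD2pi sinN sE ltr0_norm// mulNr opprK mulrC divfK// gt_eqF//.
Qed.

Lemma circle_mean_sum (N : nat) (F : nat -> R -> R) :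
  (forall k, (k < N)%N -> circle_integrable (F k)) ->
  circle_integrable (fun t => \sum_(k < N) F k t) /\
  circle_mean (fun t => \sum_(k < N) F k t) = \sum_(k < N) circle_mean (F k).
Proof.
elim: N => [_|N IH FN].
  have -> : (fun t => \sum_(k < 0) F k t) = fun=> 0.
    by apply/funext => t; rewrite big_ord0.
  by rewrite big_ord0; split; [exact: circle_integrable_cst|exact: circle_mean_cst].
have [k kN|i m] := IH; first by apply: FN; rewrite ltnS ltnW.
have -> : (fun t => \sum_(k < N.+1) F k t) =
    fun t => \sum_(k < N) F k t + F N t.
  by apply/funext => t; rewrite big_ord_recr.
rewrite big_ord_recr/= -m; split; first by apply: circle_integrableD => //; apply: FN.
by apply: circle_meanD => //; apply: FN.
Qed.

End rotations.

(** * Averages over rotations and circle means *)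

Section equidistribution.
Context {R : realType}.
Implicit Types (g phi : R -> R).

(** The average of [g] over a coset of the N-th roots of unity. *)
Definition rotation_average (N : nat) g (theta : R) : R :=
  N%:R^-1 * \sum_(k < N) g (theta + 2 * pi * k%:R / N%:R).

Lemma rotation_average_periodic (N : nat) g (theta : R) :
  (forall t, g (t + 2 * pi) = g t) ->
  forall m, rotation_average N.+1 g (theta + 2 * pi * m%:R / N.+1%:R) =
            rotation_average N.+1 g theta.
Proof.
move=> gper; elim=> [|m IH]; first by rewrite mulr0 mul0r addr0.
rewrite -IH /rotation_average; congr (_ * _).
rewrite big_ord_recr [in RHS]big_ord_recl/= addrC; congr (_ + _).
  rewrite mulr0 mul0r addr0 -[RHS]gper; congr g.
  by rewrite -!natr1; field; rewrite natr1 pnatr_eq0.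
apply: eq_bigr => i _; congr g; rewrite /bump/= add1n.
by rewrite -!natr1; field; rewrite natr1 pnatr_eq0.
Qed.

(** The average depends only on [theta] modulo 2 pi / N; for 0 <= theta < 2 pi / N
    it is a Riemann sum with one node in each of the N intervals. *)
Lemma rotation_average_Lipschitz_le (N : nat) phi (L theta : R) :
  0 <= L -> 0 <= theta ->
  (forall t, phi (t + 2 * pi) = phi t) ->
  (forall t s, phi t <= phi s + L * `|t - s|) ->
  rotation_average N.+1 phi theta <=
    circle_mean phi + L * (2 * pi / N.+1%:R).
Proof.
move=> L0 theta0 per lip.
have pp := @twopi_gt0 R.
have N0 : 0 < N.+1%:R :> R by rewrite ltr0n.
pose h : R := 2 * pi / N.+1%:R.
have h0 : 0 < h by rewrite divr_gt0.
have cphi : continuous phi.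
  move=> t; apply/cvgrPdist_lt => e e0.
  have L1 : 0 < L + 1 by rewrite ltr_wpDl.
  have d0 : 0 < e / (L + 1) by rewrite divr_gt0.
  near=> s; have ts : `|t - s| < e / (L + 1).
    by near: s; exists (e / (L + 1)).
  have Lts : L * `|t - s| < e.
    apply: le_lt_trans (_ : (L + 1) * `|t - s| < e).
      by rewrite ler_wpM2r// lerDl.
    by rewrite mulrC -ltr_pdivlMr.
  have := lip t s; have := lip s t; rewrite (distrC s t) ltr_norml; lra.
have phii (a b : R) : lebesgue_measure.-integrable `[a, b] (EFin \o phi).
  apply: continuous_compact_integrable; first exact: segment_compact.
  exact: continuous_subspaceT.
pose m := Num.truncn (theta / h).
have /andP[m1 m2] : m%:R <= theta / h < m.+1%:R.
  by apply: Num.Theory.truncn_itv; rewrite divr_ge0// ltW.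
pose th := theta - m%:R * h.
have th0 : 0 <= th <= h.
  move: m1 m2; rewrite ler_pdivlMr// ltr_pdivrMr// -natr1 mulrDl mul1r /th.
  by move=> *; apply/andP; split; lra.
have -> : rotation_average N.+1 phi theta = rotation_average N.+1 phi th.
  rewrite -(rotation_average_periodic N th per m); congr (rotation_average _ _ _).
  by rewrite /th /h; field; rewrite gt_eqF.
have H : forall K : nat, \sum_(k < K) h * (phi (th + k%:R * h) - L * h) <=
    \int[lebesgue_measure]_(t in `[0, K%:R * h]) phi t.
  elim=> [|K IH]; first by rewrite big_ord0 mul0r set_itv1 Rintegral_set1.
  rewrite big_ord_recr/=.
  have Kh : K%:R * h <= K.+1%:R * h by rewrite ler_pM2r// ler_nat.
  have := @Rintegral_itvB R phi (BLeft 0) (BRight (K.+1%:R * h)) (K%:R * h).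
  move=> /(_ (phii _ _)).
  rewrite !bnd_simp mulr_ge0 ?(ltW h0)// Kh => /(_ isT isT) E.
  have -> : \int[lebesgue_measure]_(t in `[0, (K.+1%:R * h)]) phi t =
    \int[lebesgue_measure]_(t in `[0, (K%:R * h)]) phi t +
    \int[lebesgue_measure]_(t in `](K%:R * h), (K.+1%:R * h)]) phi t.
    by rewrite -E addrC subrK.
  apply: lerD => //.
  have sub : [set` `](K%:R * h), (K.+1%:R * h)]] `<=` [set` `[(K%:R * h), (K.+1%:R * h)]].
    by move=> t /=; rewrite !in_itv/= => /andP[/ltW-> ->].
  have := @le_Rintegral _ _ R lebesgue_measure
    [set` `](K%:R * h), (K.+1%:R * h)]] (fun=> phi (th + K%:R * h) - L * h) phi.
  rewrite Rintegral_cst//= lebesgue_measure_itv/= lte_fin ltr_pM2r// ltr_nat ltnSn/=.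
  have -> : K.+1%:R * h - K%:R * h = h by rewrite -natr1; ring.
  rewrite (mulrC h (_ - _)); apply => //.
  - apply: integrableS (_ : lebesgue_measure.-integrable
      `[(K%:R * h), (K.+1%:R * h)] _) => //.
    apply: continuous_compact_integrable; first exact: segment_compact.
    by apply: continuous_subspaceT => t; apply: cvg_cst.
  - by apply: integrableS (phii (K%:R * h) (K.+1%:R * h)).
  - move=> t /=; rewrite in_itv/= => /andP[t1 t2].
    have := lip (th + K%:R * h) t.
    have ht : `|th + K%:R * h - t| <= h.
      rewrite ler_norml; move: t2 th0; rewrite -natr1 mulrDl mul1r.
      by move=> ? /andP[]; lra.
    by have := ler_wpM2l L0 ht; lra.
have := H N.+1; rewrite -mulr_sumr sumrB sumr_const card_ord.
have Nh : N.+1%:R * h = 2 * pi by rewrite /h mulrC divfK// gt_eqF.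
have e1 : (2 * pi)^-1 * (N.+1%:R * h) = 1 by rewrite Nh mulVf// gt_eqF.
rewrite Nh.
move=> {}H; rewrite /rotation_average /circle_mean -/h.
have -> : \sum_(k < N.+1) phi (th + 2 * pi * k%:R / N.+1%:R) =
    \sum_(k < N.+1) phi (th + k%:R * h).
  by apply: eq_bigr => k _; congr phi; rewrite /h; field; rewrite gt_eqF.
have -> : N.+1%:R^-1 = (2 * pi)^-1 * h.
  by rewrite /h mulrA mulVf ?mul1r// gt_eqF.
rewrite -lerBlDr; apply: le_trans (ler_wpM2l _ H); last by rewrite invr_ge0 ltW.
rewrite -(mulr_natl (L * h)).
have e2 : L * h = (2 * pi)^-1 * (N.+1%:R * h) * (L * h) by rewrite e1 mul1r.
rewrite [X in _ - X <= _]e2.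
by rewrite le_eqVlt; apply/orP; left; apply/eqP; ring.
Unshelve. all: by end_near. Qed.

End equidistribution.
Section lipschitz_envelope.
Context {R : realType}.
Implicit Types (g : R -> R).

(** The sup-convolution of [g] with L |.|: a majorant of [g] with Lipschitz
    constant L, decreasing to [g] when [g] is bounded and upper semicontinuous. *)
Definition lip_env g (L t : R) : R := sup (range (fun s => g s - L * `|t - s|)).

Context (g : R -> R) (m M : R) (gb : forall t, m <= g t <= M)
  (gper : forall t, g (t + 2 * pi) = g t)
  (gusc : forall t a, g t < a -> \forall s \near t, g s < a).

Lemma lip_env_has_sup L t : 0 <= L ->
  has_sup (range (fun s => g s - L * `|t - s|)).
Proof.
move=> L0; split; first by exists (g t - L * `|t - t|); exists t.
exists M => _ [s _ <-]; have /andP[_ sM] := gb s.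
by rewrite lerBlDr (le_trans sM)// lerDl mulr_ge0.
Qed.

Lemma lip_env_ge L t : 0 <= L -> g t <= lip_env g L t.
Proof.
move=> L0; apply: sup_upper_bound; first exact: lip_env_has_sup.
by exists t => //; rewrite subrr normr0 mulr0 subr0.
Qed.

Lemma lip_env_bounded L t : 0 <= L -> m <= lip_env g L t <= M.
Proof.
move=> L0; apply/andP; split.
  by apply: le_trans (lip_env_ge t L0); have /andP[] := gb t.
apply: sup_le_ub; first by exists (g t - L * `|t - t|); exists t.
move=> _ [s _ <-]; have /andP[_ sM] := gb s.
by rewrite lerBlDr (le_trans sM)// lerDl mulr_ge0.
Qed.

Lemma lip_env_Lipschitz L : 0 <= L ->
  forall t s, lip_env g L t <= lip_env g L s + L * `|t - s|.
Proof.
move=> L0 t s; apply: sup_le_ub; first by exists (g t - L * `|t - t|); exists t.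
move=> _ [x _ <-].
have : g x - L * `|s - x| <= lip_env g L s.
  by apply: sup_upper_bound; [exact: lip_env_has_sup|exists x].
have : L * `|s - x| <= L * `|t - s| + L * `|t - x|.
  by rewrite -mulrDr ler_wpM2l// (distrC t s) ler_distD.
by lra.
Qed.

Lemma lip_env_periodic L : 0 <= L ->
  forall t, lip_env g L (t + 2 * pi) = lip_env g L t.
Proof.
move=> L0 t; congr sup; apply/seteqP; split => _ [s _ <-].
  exists (s - 2 * pi) => //; rewrite -(gper (s - 2 * pi)) subrK.
  by congr (_ - _ * `| _ |); ring.
by exists (s + 2 * pi) => //; rewrite gper; congr (_ - _ * `| _ |); ring.
Qed.

Lemma lip_env_cvg t : lip_env g k%:R t @[k --> \oo] --> g t.
Proof.
apply/cvgrPdist_le => e e0.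
have /gusc[d /= d0 gd] : g t < g t + e by rewrite ltrDl.
near=> k.
have k0 : 0 <= k%:R :> R by [].
rewrite distrC ger0_norm ?subr_ge0 ?lip_env_ge// lerBlDr addrC.
apply: sup_le_ub; first by exists (g t - k%:R * `|t - t|); exists t.
move=> _ [s _ <-].
have [ts|ts] := ltP `|t - s| d.
  by rewrite lerBlDr ltW// ltr_wpDr ?mulr_ge0// gd.
have /andP[mt _] := gb t; have /andP[_ sM] := gb s.
have : (M - m) / d <= k%:R by near: k; exact: nbhs_infty_ger.
rewrite ler_pdivrMr// => Mk.
by have := ler_wpM2l k0 ts; lra.
Unshelve. all: by end_near. Qed.

(** The bound passes from [g] to its Lipschitz majorants, hence to their circle
    means by equidistribution as N tends to infinity, and then to the mean of
    [g] by dominated convergence. *)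
Lemma le_circle_mean_rotation (c : R) : circle_integrable g ->
  (forall (N : nat) (eta : R), 0 < eta -> exists2 theta : R, 0 <= theta &
     c <= rotation_average N.+1 g theta + eta) ->
  c <= circle_mean g.
Proof.
move=> gi H.
have lipi (k : nat) : circle_integrable (lip_env g k%:R).
  apply: usc_circle_integrable => t.
    have k1 : 0 < k.+1%:R :> R by rewrite ltr0n.
    move=> a ta; have d0 : 0 < (a - lip_env g k%:R t) / k.+1%:R.
      by rewrite divr_gt0 ?subr_gt0.
    near=> s; have ts : `|t - s| < (a - lip_env g k%:R t) / k.+1%:R.
      by near: s; exists ((a - lip_env g k%:R t) / k.+1%:R).
    move: ts; rewrite ltr_pdivlMr// -natr1.
    have := @lip_env_Lipschitz k%:R (ler0n _ _) s t; rewrite distrC.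
    by have := normr_ge0 (t - s); lra.
  exists m; near=> s; by have /andP[] := @lip_env_bounded k%:R s (ler0n _ _).
have step (k : nat) : c <= circle_mean (lip_env g k%:R).
  have k0 : 0 <= k%:R :> R by [].
  apply/ler_addgt0Pr => e e0; have e20 : 0 < e / 2 by rewrite divr_gt0.
  have [N NP] : exists N : nat, k%:R * (2 * pi / N.+1%:R) <= e / 2.
    exists (Num.truncn (k%:R * (2 * pi) / (e / 2))).
    rewrite mulrA ler_pdivrMr ?ltr0n// [leRHS]mulrC -ler_pdivrMr//.
    by apply: ltW; apply: truncnS_gt.
  have [theta th0 cth] := H N _ e20.
  have := @rotation_average_Lipschitz_le _ N _ _ _ k0 th0 (lip_env_periodic k0)
    (lip_env_Lipschitz k0).
  have : rotation_average N.+1 g theta <= rotation_average N.+1 (lip_env g k%:R) theta.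
    rewrite /rotation_average ler_pM2l ?invr_gt0 ?ltr0n//.
    by apply: ler_sum => i _; apply: lip_env_ge.
  move: NP cth; move: (k%:R * (2 * pi / N.+1%:R)) => x.
  by move: (rotation_average _ _ _) (rotation_average _ _ _) => *; lra.
have cv : circle_mean (lip_env g k%:R) @[k --> \oo] --> circle_mean g.
  apply: cvgM; first exact: cvg_cst.
  apply: fine_cvg; rewrite fineK; last exact: integrable_fin_num.
  apply: (@dominated_cvg _ _ _ lebesgue_measure _ _ (fun k t => (lip_env g k%:R t)%:E)
    (EFin \o g) (cst (`|m| + `|M|)%:E)) => //=.
  - by move=> k; have /integrableP[] := lipi k.
  - by move=> t _; apply: cvg_EFin; [near=> k|exact: lip_env_cvg].
  - exact: circle_integrable_cst.
  - move=> k t _; rewrite lee_fin.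
    have /andP[h1 h2] := @lip_env_bounded k%:R t (ler0n _ _).
    rewrite ler_norml; have := ler_norm M; have := ler_norm (- m).
    by have := normr_ge0 M; have := normr_ge0 m; rewrite normrN; lra.
rewrite -(cvg_lim _ cv)//; apply: limr_ge; first by apply/cvg_ex; eexists; exact: cv.
by near=> k; apply: step.
Unshelve. all: by end_near. Qed.

End lipschitz_envelope.

(** * From small circles to all circles *)

Section global_submean.
Context {R : realType} {n : nat}.
Implicit Types (z y x a b : CC[R]_n) (f g : CC[R]_n -> R) (O : set CC[R]_n).

Lemma natrV_mulrn (N : nat) (x : R) : N.+1%:R^-1 * (x *+ N.+1) = x.
Proof. by rewrite -(mulr_natl x) mulrA mulVf ?mul1r// pnatr_eq0. Qed.

Lemma arc0 a b (t : R) : arc a b 0 t = a.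
Proof.
apply/eqP; rewrite -subr_eq0; apply/eqP; apply: enorm_eq0.
by rewrite enorm_arc normr0 mul0r.
Qed.

Lemma arc_periodic a b (s t : R) : arc a b s (t + 2 * pi) = arc a b s t.
Proof.
by rewrite !arcE mulr_natl cosD2pi sinD2pi.
Qed.

(** A small circle inside the disc, rotated about the centre of the disc, is a
    circle in the rotated direction with the same parameter; this avoids any
    change of variable in the circle means. *)
Lemma arc_rotate a b (s t al rho th s' t' : R) :
  s * cos t + rho * cos th = s' * cos t' ->
  s * sin t + rho * sin th = s' * sin t' ->
  arc (arc a b s (t + al)) ((cos al +i* sin al)%C *: b) rho th =
  arc a b s' (t' + al).
Proof.
move=> hc hs; rewrite !arcE -addrA scalerA -scalerDl; congr (a + _ *: b).
rewrite !cosD !sinD; apply/eqP; rewrite eq_complex/=; apply/andP; split; apply/eqP.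
- have := congr1 (fun u => u * cos al) hc; have := congr1 (fun u => u * sin al) hs.
  by lra.
- have := congr1 (fun u => u * sin al) hc; have := congr1 (fun u => u * cos al) hs.
  by lra.
Qed.

Lemma chord_sqr (s t rho th s' t' : R) :
  s * cos t + rho * cos th = s' * cos t' ->
  s * sin t + rho * sin th = s' * sin t' ->
  s' ^+ 2 = s ^+ 2 + rho ^+ 2 + 2 * s * rho * (cos t * cos th + sin t * sin th).
Proof.
move=> hc hs.
have -> : s' ^+ 2 = (s' * cos t') ^+ 2 + (s' * sin t') ^+ 2.
  by rewrite !exprMn -mulrDr cos2Dsin2 mulr1.
rewrite -hc -hs; have := congr1 (fun u => s ^+ 2 * u) (cos2Dsin2 t).
by have := congr1 (fun u => rho ^+ 2 * u) (cos2Dsin2 th); lra.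
Qed.

Lemma arc_near2 a b (s t r : R) : 0 < r ->
  \forall p \near (s, t), eball (arc a b s t) r (arc a b p.1 p.2).
Proof.
move=> r0; have r20 : 0 < r / 2 by rewrite divr_gt0.
have K0 : 0 < enorm b + 1 by rewrite ltr_wpDl// enorm_ge0.
have d0 : 0 < r / 2 / (enorm b + 1) by rewrite divr_gt0.
exists ([set s' | `|s - s'| < r / 2 / (enorm b + 1)],
        [set t' | eball (arc a b s t) (r / 2) (arc a b s t')]).
  split; last exact: arc_near.
  by exists (r / 2 / (enorm b + 1)).
move=> [s' t'] /= [h1 h2]; rewrite /eball/= in h2 *.
rewrite ltr_pdivlMr in h1; last exact: K0.
apply: le_lt_trans (ler_enormB _ (arc a b s t') _) _.
have -> : r = r / 2 + r / 2 by field.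
apply: ltrD h2.
have -> : arc a b s' t' - arc a b s t' = arc 0 b (s' - s) t' - 0.
  rewrite !arcE opprD addrACA subrr !add0r subr0 -scalerBl; congr (_ *: _).
  by apply/eqP; rewrite eq_complex/=; apply/andP; split; apply/eqP; ring.
rewrite enorm_arc distrC; apply: le_lt_trans h1.
by rewrite ler_wpM2l// lerDl.
Qed.

Lemma usc_sum (T : topologicalType) (N : nat) (F : nat -> T -> R) (x : T) :
  (forall k, forall c, F k x < c -> \forall y \near x, F k y < c) ->
  forall c, \sum_(k < N) F k x < c -> \forall y \near x, \sum_(k < N) F k y < c.
Proof.
move=> FU; elim: N => [|N IH] c.
  by rewrite big_ord0 => c0; near=> y; rewrite big_ord0.
rewrite big_ord_recr/= => h.
pose e := (c - (\sum_(k < N) F k x + F N x)) / 2.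
have e0 : 0 < e by rewrite divr_gt0// subr_gt0.
have h1 : \forall y \near x, \sum_(k < N) F k y < \sum_(k < N) F k x + e.
  by apply: IH; rewrite ltrDl.
have h2 : \forall y \near x, F N y < F N x + e by apply: FU; rewrite ltrDl.
near=> y; rewrite big_ord_recr/=.
have -> : c = \sum_(k < N) F k x + e + (F N x + e) by rewrite /e; field.
by apply: ltrD; near: y.
Unshelve. all: by end_near. Qed.

Lemma rotation_usc O f a b (N : nat) (eta : R) (p : R * R) :
  lpsh O f -> (forall t, O (arc a b p.1 t)) ->
  let G := fun p : R * R =>
    rotation_average N.+1 (fun t => f (arc a b p.1 t)) p.2 + eta * p.1 ^+ 2 in
  forall c, G p < c -> \forall q \near p, G q < c.
Proof.
move: p => [s t] fO /= Os c Gc.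
have N0 : 0 < N.+1%:R :> R by rewrite ltr0n.
pose F (k : nat) (q : R * R) := f (arc a b q.1 (q.2 + 2 * pi * k%:R / N.+1%:R)).
set G0 := (X in X < c) in Gc.
pose e := (c - G0) / 2.
have e0 : 0 < e by rewrite divr_gt0// subr_gt0.
have H1 : \forall q \near (s, t), \sum_(k < N.+1) F k q <
    \sum_(k < N.+1) F k (s, t) + N.+1%:R * e.
  apply: usc_sum; last by rewrite ltrDl mulr_gt0.
  move=> k c' Fc'; rewrite /F/=.
  have [+ _ _] := fO _ (Os (t + 2 * pi * k%:R / N.+1%:R)) => /(_ c' Fc')[d d0 fd].
  have [[A B] [/= As Bt] AB] := arc_near2 a b s (t + 2 * pi * k%:R / N.+1%:R) d0.
  exists (A, [set t' | B (t' + 2 * pi * k%:R / N.+1%:R)]).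
    split => //=; have : (fun t' : R => t' + 2 * pi * k%:R / N.+1%:R) @ t -->
        t + 2 * pi * k%:R / N.+1%:R.
      by apply: cvgD; [exact: cvg_id|exact: cvg_cst].
    exact.
  move=> [s' t'] /= [As' Bt']; apply: fd.
  exact: (AB (s', t' + 2 * pi * k%:R / N.+1%:R)).
have H2 : \forall q \near (s, t), eta * q.1 ^+ 2 < eta * s ^+ 2 + e.
  have cs : continuous (fun x : R => eta * x ^+ 2).
    by move=> x; apply: cvgM; [exact: cvg_cst|exact: exprn_continuous].
  have h : \forall x \near s, eta * x ^+ 2 < eta * s ^+ 2 + e.
    near=> x; have : `|eta * s ^+ 2 - eta * x ^+ 2| < e.
      near: x; apply: (@cvgr_dist_lt _ _ _ (nbhs s)) => //; exact: cs.
    by rewrite ltr_norml; lra.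
  by exists ([set x | eta * x ^+ 2 < eta * s ^+ 2 + e], setT);
    [split => //=; exact: filterT|move=> [x y] []].
near=> q.
have -> : c = N.+1%:R^-1 * (\sum_(k < N.+1) F k (s, t) + N.+1%:R * e) +
    (eta * s ^+ 2 + e).
  have -> : c = G0 + e + e by rewrite /e; field.
  rewrite /G0 /rotation_average [in RHS]mulrDr mulKf ?gt_eqF//.
  by rewrite -addrA addrACA -!addrA; congr (_ + _); rewrite addrA addrC.
apply: ltrD; last by near: q.
rewrite /rotation_average ltr_pM2l ?invr_gt0//.
by near: q.
Unshelve. all: by end_near. Qed.

(** The average of [f] over N rotations of the disc, plus eta |w|^2, attains its
    maximum over the closed disc.  At an interior point this contradicts the
    local sub-mean property, because |w|^2 gains rho^2 in the mean over a circle
    of radius rho.  At the centre the average equals f(a), so f(a) is bounded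
    by the average at some boundary point. *)
Lemma lpsh_rotation O f a b (r : R) (N : nat) (eta : R) :
  lpsh O f -> open O -> 0 < r -> 0 < eta ->
  (forall s t, 0 <= s <= r -> O (arc a b s t)) ->
  exists2 theta : R, 0 <= theta &
    f a <= rotation_average N.+1 (fun t => f (arc a b r t)) theta + eta * r ^+ 2.
Proof.
move=> fO oO r0 eta0 disc.
have pp := @twopi_gt0 R.
have N0 : 0 < N.+1%:R :> R by rewrite ltr0n.
pose al (k : nat) : R := 2 * pi * k%:R / N.+1%:R.
pose G (p : R * R) : R :=
  rotation_average N.+1 (fun t => f (arc a b p.1 t)) p.2 + eta * p.1 ^+ 2.
pose K : set (R * R) := `[0, r] `*` `[0, 2 * pi].
have cK : compact K by apply: compact_setX; apply: segment_compact.
have K0 : K (0, 0) by split; rewrite /= in_itv/= lexx ltW.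
have [||[s t] [/= ]] := @usc_attains_max R _ K G cK.
- by exists (0, 0).
- move=> [s t] [/= sK _] c; apply: (rotation_usc fO) => u.
  by apply: disc; rewrite /= in_itv in sK.
rewrite !in_itv/= => s0r t0 Gmax.
have Ga : f a = G (0, 0).
  rewrite /G/= expr0n/= mulr0 addr0 /rotation_average.
  have -> : \sum_(k < N.+1) f (arc a b 0 (0 + 2 * pi * k%:R / N.+1%:R)) =
    \sum_(k < N.+1) f a by apply: eq_bigr => k _; rewrite arc0.
  by rewrite sumr_const card_ord natrV_mulrn.
have /andP[s0 sr] := s0r; have /andP[t0' _] := t0.
have [sr'|sr'] := ltP s r; last first.
  have sE : s = r by apply/eqP; rewrite eq_le sr.
  by exists t => //; rewrite Ga -sE; apply: Gmax.
exfalso.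
pose z k := arc a b s (t + al k).
pose d k := (cos (al k) +i* sin (al k))%C *: b.
have Oz k : O (z k) by apply: disc.
have [||rho1 rho10 H1] := @fin_radius R 'I_N.+1 (fun k rho0 => forall rho,
  0 < rho < rho0 -> circle_integrable (f \o arc (z k) (d k) rho) /\
  f (z k) <= circle_mean (f \o arc (z k) (d k) rho) + eta / 2 * rho ^+ 2).
- move=> k x x' x'0 x'x H rho /andP[h1 h2]; apply: H.
  by rewrite h1/=; apply: lt_le_trans x'x.
- move=> k; have [_ _ /(_ (d k) (eta / 2))[|x x0 Hx]] := fO _ (Oz k).
    by rewrite divr_gt0.
  have [x' x'0 Hx'] := lpsh_arc_integrable (d k) oO fO (Oz k).
  exists (Num.min x x'); first by rewrite lt_min x0.
  move=> rho /andP[h1]; rewrite lt_min => /andP[h2 h3].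
  by split; [apply: (Hx' rho _).1|apply: Hx]; rewrite h1.
(* a radius that is small for all rotated centres and stays in the disc *)
pose rho := Num.min rho1 (r - s) / 2.
have m0 : 0 < Num.min rho1 (r - s) by rewrite lt_min rho10 subr_gt0.
have rho0 : 0 < rho by rewrite divr_gt0.
have [rho_1 rhors] : rho < rho1 /\ rho < r - s.
  have : rho < Num.min rho1 (r - s) by rewrite /rho; lra.
  by rewrite lt_min => /andP[].
have {}H1 k : (k < N.+1)%N -> circle_integrable (f \o arc (z k) (d k) rho) /\
    f (z k) <= circle_mean (f \o arc (z k) (d k) rho) + eta / 2 * rho ^+ 2.
  by move=> kN; apply: (H1 (Ordinal kN)); rewrite rho0.
have [i m] := @circle_mean_sum R N.+1 (fun k => f \o arc (z k) (d k) rho)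
  (fun k kN => (H1 k kN).1).
have ub th : N.+1%:R^-1 * \sum_(k < N.+1) f (arc (z k) (d k) rho th) <=
   trig2 (G (s, t) - eta * (s ^+ 2 + rho ^+ 2))
     (- (2 * eta * s * rho * cos t)) (- (2 * eta * s * rho * sin t)) 0 0 th.
  have [s' [t' [s'0 t'P hc hs]]] := polar (s * cos t + rho * cos th)
     (s * sin t + rho * sin th).
  have s'2 := chord_sqr hc hs.
  have s'r : s' <= r.
    rewrite -(@ler_pXn2r _ 2)// ?nnegrE ?(ltW r0)// s'2.
    apply: (@le_trans _ _ ((s + rho) ^+ 2)); last first.
      by rewrite ler_pXn2r ?nnegrE ?(ltW r0) ?addr_ge0 ?(ltW rho0)//; lra.
    have : cos t * cos th + sin t * sin th <= 1 by rewrite -cosB cos_le1.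
    have : 0 <= 2 * s * rho by rewrite !mulr_ge0// ltW.
    by move: (cos t * cos th + _) => u u0 u1; nra.
  have := Gmax (s', t'); rewrite /K/= !in_itv/= s'0 s'r t'P => /(_ (conj isT isT)).
  rewrite {1}/G/= /rotation_average.
  have -> : \sum_(k < N.+1) f (arc a b s' (t' + 2 * pi * k%:R / N.+1%:R)) =
     \sum_(k < N.+1) f (arc (z k) (d k) rho th).
    by apply: eq_bigr => k _; rewrite /z /d (arc_rotate _ _ _ hc hs).
  rewrite s'2 /trig2; move: (_ * \sum_(k < _) _) (G (s, t)) => u g1.
  by lra.
have [i2 m2] := trig2_mean (G (s, t) - eta * (s ^+ 2 + rho ^+ 2))
     (- (2 * eta * s * rho * cos t)) (- (2 * eta * s * rho * sin t)) 0 0.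
have := le_circle_mean (circle_integrableZ N.+1%:R^-1 i) i2 ub.
rewrite m2 circle_meanZ// m.
have : rotation_average N.+1 (fun t => f (arc a b s t)) t <=
   N.+1%:R^-1 * \sum_(k < N.+1) circle_mean (f \o arc (z k) (d k) rho)
   + eta / 2 * rho ^+ 2.
  have -> : eta / 2 * rho ^+ 2 =
    N.+1%:R^-1 * \sum_(k < N.+1) (eta / 2 * rho ^+ 2).
    by rewrite sumr_const card_ord natrV_mulrn.
  rewrite -mulrDr -big_split/= /rotation_average ler_pM2l ?invr_gt0//.
  by apply: ler_sum => k _; apply: (H1 k (ltn_ord k)).2.
have e2 : 0 < eta * rho ^+ 2 by rewrite mulr_gt0// exprn_gt0.
rewrite /G/=; move: (rotation_average _ _ _) (_ * \sum_(k < _) _) => u v.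
by lra.
Unshelve. all: by end_near. Qed.

(** The local sub-mean property implies the sub-mean value inequality on every
    circle that bounds a disc in [O]. *)
Lemma lpsh_submean O f a b (r : R) : lpsh O f -> open O -> 0 < r ->
  (forall s t, 0 <= s <= r -> O (arc a b s t)) ->
  circle_integrable (f \o arc a b r) /\ f a <= circle_mean (f \o arc a b r).
Proof.
move=> fO oO r0 disc.
have disc_r t : O (arc a b r t) by apply: disc; rewrite lexx ltW.
have gi : circle_integrable (f \o arc a b r).
  by apply: arc_integrable => t; have [] := fO _ (disc_r t).
split => //.
have gusc (t c : R) : f (arc a b r t) < c -> \forall s \near t, f (arc a b r s) < c.
  have [+ _ _] := fO _ (disc_r t) => /(_ c)/[apply] -[e e0 fe].
  by near=> s; apply: fe; near: s; exact: arc_near.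
have glb (t : R) : exists m, \forall s \near t, m <= f (arc a b r s).
  have [_ [m [e e0 fe]] _] := fO _ (disc_r t); exists m.
  by near=> s; apply: fe; near: s; exact: arc_near.
have gper t : f (arc a b r (t + 2 * pi)) = f (arc a b r t) by rewrite arc_periodic.
have cI : compact `[0, (2 * pi : R)] by exact: segment_compact.
have [|M gM] := @compact_bound_above _ _ _ (fun t => f (arc a b r t)) cI.
  move=> t _; exists (f (arc a b r t) + 1).
  have /gusc gt1 : f (arc a b r t) < f (arc a b r t) + 1 by rewrite ltrDl.
  by near=> s; apply/ltW; near: s.
have [|m gm] := @compact_bound_below _ _ _ (fun t => f (arc a b r t)) cI.
  by move=> t _; exact: glb.
have gb t : m <= f (arc a b r t) <= M.
  have [s [th [s0 thP c1 c2]]] := polar (r * cos t) (r * sin t).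
  have sr : s = r.
    apply/eqP; rewrite -(@eqrXn2 _ 2) ?(ltW r0)//; apply/eqP.
    rewrite -[LHS]mulr1 -[RHS]mulr1 -[X in _ * X = _](cos2Dsin2 th).
    by rewrite -(cos2Dsin2 t) !mulrDr -!exprMn -c1 -c2.
  have -> : arc a b r t = arc a b r th by rewrite !arcE c1 c2 sr.
  by rewrite gm ?gM// /= in_itv.
apply: (le_circle_mean_rotation gb gper gusc gi) => N eta eta0.
have e0 : 0 < eta / r ^+ 2 by rewrite divr_gt0// exprn_gt0.
have [th th0 H] := lpsh_rotation N fO oO r0 e0 disc.
exists th => //; move: H; rewrite divfK// gt_eqF// exprn_gt0//.
Unshelve. all: by end_near. Qed.

End global_submean.

(** * Plurisubharmonic functions and their suprema over balls *)

Section psh_conversion.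
Context {R : realType} {n : nat}.
Implicit Types (z y x a b : CC[R]_n) (f g : CC[R]_n -> R) (O : set CC[R]_n).

Lemma nbhs_normc (w : CC[R]) (d : R) : 0 < d ->
  nbhs w [set w' | Normc.normc (w' - w) < d].
Proof.
move=> d0; apply/nbhs_ballP; exists d%:C%C; first by rewrite /= ltcR.
move=> w'; rewrite /ball/= abs_normc ltcR => h.
by rewrite -[X in X < _](normcN (w' - w : Rcomplex R)) opprB.
Qed.

Lemma arc_slice a b (c : CC[R]) (r t : R) :
  arc (a + c *: b) b r t = a + circle_pt c r t *: b.
Proof.
by rewrite /arc -addrA -scalerDl; congr (_ + _ *: _); rewrite /circle_pt add0r.
Qed.

Lemma circle_mean_EFin (g : R -> R) : circle_integrable g ->
  (((2 * pi)^-1)%:E * \int[lebesgue_measure]_(t in `[0%R, (2 * pi)%R]) (g t)%:E)%E =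
  (circle_mean g)%:E.
Proof.
move=> gi; rewrite /circle_mean /Rintegral EFinM fineK//.
exact: integrable_fin_num.
Qed.

Lemma lpsh_psh O f : open O -> lpsh O f -> psh O (EFin \o f).
Proof.
move=> oO fO; split.
- by move=> z _; rewrite /= ltry.
- move=> z Oz c /=; rewrite lte_fin => fc.
  have [+ _ _] := fO z Oz => /(_ c fc)[r r0 H].
  apply/nbhs_eballP; exists r => // y yr _ /=.
  by rewrite lte_fin; apply: H.
move=> a b; split.
- by move=> z _; rewrite /= ltry.
- move=> w Ow c /=; rewrite lte_fin => fc.
  have [+ _ _] := fO _ Ow => /(_ c fc)[r r0 H].
  have K0 : 0 < enorm b + 1 by rewrite ltr_wpDl// enorm_ge0.
  have d0 : 0 < r / (enorm b + 1) by rewrite divr_gt0.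
  move: (nbhs_normc w d0); apply: filterS => w' /= w'w _.
  rewrite lte_fin; apply: H; rewrite /eball/= opprD addrACA subrr add0r -scalerBl.
  rewrite enormZ; rewrite ltr_pdivlMr in w'w; last exact: K0.
  by apply: le_lt_trans w'w; rewrite ler_wpM2l ?normc_ge0// lerDl.
- move=> c r r0 disc.
  have [|i m] := @lpsh_submean R n O f (a + c *: b) b r fO oO r0.
    move=> s t /andP[s0 sr]; rewrite arc_slice; apply: disc.
    have -> : circle_pt c s t - c = circle_pt 0 s t :> CC[R].
      by rewrite /circle_pt add0r addrC addKr.
    by rewrite normc_circle_pt ger0_norm.
  have E : (fun t => (f (a + circle_pt c r t *: b))%:E) =
      (fun t => ((f \o arc (a + c *: b) b r) t)%:E).
    by apply/funext => t; rewrite /= arc_slice.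
  by rewrite /= E circle_mean_EFin// lee_fin.
Qed.

End psh_conversion.

Section sup_regularisation.
Context {R : realType}.

Lemma usc_ereal_measurable (h : R -> \bar R) :
  (forall t (c : R), (h t < c%:E)%E -> \forall s \near t, (h s < c%:E)%E) ->
  measurable_fun setT h.
Proof.
move=> H.
have lN : lower_semicontinuous (fun t => (- h t)%E).
  move=> t c; rewrite lteNr => /H gt.
  exists [set s | (h s < (- c)%:E)%E] => // s /=.
  by rewrite lteNr.
have mN := measurable_realfun.lower_semicontinuous_measurable lN.
have : measurable_fun setT (fun t => - - h t)%E.
  by apply: measurableT_comp mN; exact: oppe_measurable.
by congr (measurable_fun _ _); apply/funext => t; rewrite oppeK.
Qed.

(** The integrals may be infinite here, so the positive and negative parts are
    compared separately. *)
Lemma le_integral_circle (h k : R -> \bar R) :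
  measurable_fun setT h -> measurable_fun setT k -> (forall t, (h t <= k t)%E) ->
  (\int[lebesgue_measure]_(t in `[0%R, (2 * pi)%R]) h t <=
   \int[lebesgue_measure]_(t in `[0%R, (2 * pi)%R]) k t)%E.
Proof.
move=> mh mk hk; rewrite integralE [leRHS]integralE.
have mh' := measurable_funTS mh : measurable_fun `[0, 2 * pi]%classic h.
have mk' := measurable_funTS mk : measurable_fun `[0, 2 * pi]%classic k.
apply: leeB; apply: ge0_le_integral => //.
- exact: measurable_realfun.measurable_funepos.
- exact: measurable_realfun.measurable_funepos.
- by move=> t It; apply: (@funepos_le _ _ setT) => //; rewrite inE.
- exact: measurable_realfun.measurable_funeneg.
- exact: measurable_realfun.measurable_funeneg.
- by move=> t It; apply: (@funeneg_le _ _ setT) => //; rewrite inE.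
Qed.

Context {n : nat}.
Implicit Types (z y x a b : CC[R]_n).

(** A Lebesgue number argument: a property that holds locally with a uniform
    small scale holds on a compact set with a single scale. *)
Lemma compact_uniform (K : set CC[R]_n) (P : R -> CC[R]_n -> Prop) :
  compact K ->
  (forall x, K x -> exists2 r : R, 0 < r & forall d x', 0 < d < r ->
     eball x r x' -> P d x') ->
  exists2 d : R, 0 < d & forall x, K x -> P d x.
Proof.
move=> /compact_near_coveringP cK H.
have : \forall d \near 0^'+, K `<=` P d.
  apply: (cK R 0^'+ P) => x Kx; have [r r0 Hr] := H x Kx.
  exists (eball x r, [set d | 0 < d < r]).
    split; first exact: nbhs_eball.
    by near=> d; apply/andP; split; near: d;
      [exact: nbhs_right_gt|exact: nbhs_right_lt].
  by move=> [x' d] /= [h1 h2]; apply: Hr.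
move=> Hd; near (0 : R)^'+ => d; exists d; first by near: d; exact: nbhs_right_gt.
by near: d.
Unshelve. all: by end_near. Qed.

Lemma psh_arc (V : set CC[R]_n) (v : CC[R]_n -> \bar R) y b (rho : R) :
  psh V v -> 0 < rho -> (forall s t, 0 <= s <= rho -> V (arc y b s t)) ->
  measurable_fun setT (fun t : R => v (arc y b rho t)) /\
  (v y <= ((2 * pi)^-1)%:E *
     \int[lebesgue_measure]_(t in `[0%R, (2 * pi)%R]) v (arc y b rho t))%E.
Proof.
move=> [_ vusc vsub] rho0 disc; split.
  apply: usc_ereal_measurable => t c vc.
  have Vt : V (arc y b rho t) by apply: disc; rewrite lexx ltW.
  have /nbhs_eballP[r r0 H] := vusc _ Vt c vc.
  near=> s; apply: H; first by near: s; exact: arc_near.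
  by apply: disc; rewrite lexx ltW.
have [_ _ /(_ 0 rho rho0)] := vsub y b.
rewrite scale0r addr0; apply=> w wrho /=.
have [s [t [s0 _ c1 c2]]] := polar (complex.Re w) (complex.Im w).
have -> : y + w *: b = arc y b s t.
  by rewrite arcE -c1 -c2; case: w {wrho c1 c2}.
apply: disc; rewrite s0/=; apply: le_trans wrho; rewrite subr0.
rewrite -(@ler_pXn2r _ 2)// ?nnegrE ?normc_ge0// normc_sqr c1 c2.
by rewrite !exprMn -mulrDr cos2Dsin2 mulr1.
Unshelve. all: by end_near. Qed.

Lemma within_continuous_eball (X : set CC[R]_n) (u : CC[R]_n -> R) :
  {within X, continuous u} -> forall x, X x -> forall e : R, 0 < e ->
  exists2 r : R, 0 < r & forall y, X y -> eball x r y -> `|u y - u x| < e.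
Proof.
move=> /subspace_continuousP cu x Xx e e0.
have := cu x Xx _ (nbhsx_ballx (u x) e e0).
move=> /nbhs_eballP[r r0 H]; exists r => // y Xy yr.
by have := H y yr Xy; rewrite /ball/= distrC.
Qed.

Lemma closure_enorm_le (S : set CC[R]_n) (M : R) :
  (forall z, S z -> enorm z <= M) -> forall z, closure S z -> enorm z <= M.
Proof.
move=> SM z /closure_eball Sz; apply/ler_addgt0Pr => e e0.
have [y /SM yM zy] := Sz e e0.
rewrite -[z](subrK y); apply: le_trans (ler_enormD _ _) _.
by rewrite addrC lerD// enormBC ltW.
Qed.

Lemma closure_bounded_compact (S : set CC[R]_n) (M : R) :
  (forall z, S z -> enorm z <= M) -> compact (closure S).
Proof.
move=> SM; apply: (@bounded_closed_compact _ _ _ M); first exact: closed_closure.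
exact: closure_enorm_le.
Qed.

Lemma closed_eball_compact z (d : R) : compact [set y | enorm (y - z) <= d].
Proof.
apply: (@bounded_closed_compact _ _ _ (d + enorm z)).
  move=> y yc /=; rewrite leNgt; apply/negP => dy.
  have [|y' /= y'd yy'] := (closure_eball _ _).1 yc (enorm (y - z) - d).
    by rewrite subr_gt0.
  have := ler_enormB y y' z; rewrite (enormBC y y').
  move: y'd yy'; move: (enorm _) (enorm _) (enorm _) => p q s; lra.
move=> y /= yd; rewrite -[y](subrK z); apply: le_trans (ler_enormD _ _) _.
by rewrite lerD2r.
Qed.

(** With [v] plurisubharmonic near the closure of [S] and close to [u] on it, let
    g(z) be the supremum of [v] over the closed ball of radius [delta] about z.
    If z is at distance less than [delta] from x in the closure, then g(z) is at
    least v(x); upper semicontinuity and compactness give the upper bound.  A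
    supremum of translates inherits the sub-mean value inequality. *)
Lemma sup_regularisation (X S : set CC[R]_n) (u : CC[R]_n -> R) (eps M : R) :
  {within X, continuous u} -> closure S `<=` X ->
  (forall z, S z -> enorm z <= M) ->
  psh_closure S u -> 0 < eps ->
  exists (delta : R) g, [/\ 0 < delta,
    lpsh [set z | exists2 x, closure S x & eball x delta z] g &
    forall y x, (exists2 x', closure S x' & eball x' delta y) -> X x ->
      eball x delta y -> `|g y - u x| <= eps].
Proof.
move=> cu SX SM [V' [v' [VP' _ vpsh' happ]]] eps0.
(* the final estimate adds up five errors of size e *)
pose e := eps / 8; have e0 : 0 < e by rewrite divr_gt0.
have [N _ /(_ N (leqnn N)) vK0] := happ e e0.
pose V := V' N; pose v := v' N; set K := closure S.
have [oV KV] : open V /\ K `<=` V := VP' N.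
have vpsh : psh V v := vpsh' N.
have vK z : K z -> ((u z - e)%:E <= v z)%E /\ (v z <= (u z + e)%:E)%E.
  move=> /vK0; rewrite -/v; case: (v z) => [r| |] //=.
  by rewrite lee_fin ler_norml !lee_fin => /andP[? ?]; split; lra.
have cK : compact K by exact: closure_bounded_compact SM.
have [_ vusc _] := vpsh.
have vusc' y (c : R) : V y -> (v y < c%:E)%E ->
    exists2 r : R, 0 < r & forall y', eball y r y' -> V y' /\ (v y' < c%:E)%E.
  move=> Vy vc; have /nbhs_eballP[r1 r10 H1] := vusc y Vy c vc.
  have [r2 r20 H2] := open_eball oV Vy.
  exists (Num.min r1 r2); first by rewrite lt_min r10.
  move=> y'; rewrite /eball/= lt_min => /andP[h1 h2].
  by have V2 := H2 _ h2; split => //; apply: H1.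
have [|d d0 dP] := @compact_uniform K (fun d x => X x ->
    (forall y, eball x (2 * d) y -> V y /\ (v y < (u x + 3 * e)%:E)%E) /\
    (forall x', X x' -> eball x (2 * d) x' -> `|u x' - u x| < 2 * e)) cK.
  move=> x Kx; have Xx := SX x Kx.
  have [|r1 r10 H1] := vusc' x (u x + 2 * e) (KV x Kx).
    by apply: le_lt_trans (vK x Kx).2 _; rewrite lte_fin; lra.
  have [r2 r20 H2] := within_continuous_eball cu Xx e0.
  (* a point within 2 d of x' is then closer to x than both radii *)
  exists (Num.min r1 r2 / 4).
    by rewrite divr_gt0// lt_min r10.
  move=> d x' /andP[d0 dr] xx' Xx'.
  have [m1 m2] : Num.min r1 r2 <= r1 /\ Num.min r1 r2 <= r2.
    by rewrite !ge_min !lexx orbT.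
  move: (Num.min r1 r2) dr xx' m1 m2 => m dr xx' m1 m2.
  have near2 y : eball x' (2 * d) y -> enorm (y - x) < m.
    rewrite /eball/= in xx' *; have := ler_enormB y x' x.
    by move: xx'; move: (enorm _) (enorm _) (enorm _) => p q s; lra.
  have x'x : enorm (x' - x) < m.
    by apply: near2; rewrite /eball/= subrr enorm0 mulr_gt0.
  have ux' : `|u x' - u x| < e by apply: H2 => //; apply: lt_le_trans m2.
  split=> [y /near2 yx|x'' Xx'' /near2 yx].
    have [|Vy vy] := H1 y; first exact: lt_le_trans m1.
    split => //; apply: lt_le_trans vy _; rewrite lee_fin.
    by move: ux'; rewrite ltr_norml; lra.
  have : `|u x'' - u x| < e by apply: H2 => //; apply: lt_le_trans m2.
  by move: ux'; rewrite !ltr_norml; lra.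
pose B z := [set y | enorm (y - z) <= d].
pose s z : \bar R := ereal_sup (v @` B z).
pose g z : R := fine (s z).
set O := [set z | exists2 x, K x & eball x d z].
have oO : open O.
  apply: eball_openP => z [x Kx xz].
  have [r r0 H] := open_eball (@eball_open _ _ x d) xz.
  by exists r => // y /H ?; exists x.
have B2 x z y : eball x d z -> B z y -> eball x (2 * d) y.
  rewrite /eball /B/=; have := ler_enormB y z x.
  by move: (enorm _) (enorm _) (enorm _) => p q t; lra.
have sb x z : K x -> eball x d z ->
    ((u x - e)%:E <= s z /\ s z <= (u x + 3 * e)%:E)%E.
  move=> Kx xz; split.
    apply: le_trans (vK x Kx).1 _; apply: ereal_sup_ubound; exists x => //.
    by rewrite /B/= enormBC ltW.
  apply/ereal_supP => _ [y yB <-]; apply: ltW.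
  by apply: ((dP x Kx (SX x Kx)).1 y _).2; apply: B2 yB.
have gE z : O z -> (g z)%:E = s z.
  move=> [x Kx xz]; rewrite fineK//.
  by have := sb x z Kx xz; case: (s z) => // -[].
have gb x z : K x -> eball x d z -> u x - e <= g z <= u x + 3 * e.
  move=> Kx xz; have := sb x z Kx xz; rewrite -gE; last by exists x.
  by rewrite !lee_fin => -[-> ->].
have BV z y : O z -> B z y -> V y.
  move=> [x Kx xz] yB; apply: ((dP x Kx (SX x Kx)).1 y _).1; exact: B2 yB.
have vg z y : O z -> B z y -> (v y <= (g z)%:E)%E.
  by move=> Oz yB; rewrite gE//; apply: ereal_sup_ubound; exists y.
have gusc z : O z -> usc_at g z.
  move=> Oz a ga.
  pose a' := (g z + a) / 2.
  have [h1 h2] : g z < a' /\ a' < a by rewrite /a'; lra.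
  have [|r r0 rP] := @compact_uniform (B z) (fun r y =>
    forall y', eball y r y' -> (v y' < a'%:E)%E) (@closed_eball_compact z d).
    move=> y yB; have [|r r0 H] := vusc' y a' (BV _ _ Oz yB).
      by apply: le_lt_trans (vg _ _ Oz yB) _; rewrite lte_fin.
    exists (r / 2); first by rewrite divr_gt0.
    move=> t x' /andP[t0 tr] yx' y' x'y'; apply: (H y' _).2.
    move: yx' x'y'; rewrite /eball/=; have := ler_enormB y' x' y.
    by move: (enorm _) (enorm _) (enorm _) => p q w; lra.
  have [r2 r20 H2] := open_eball oO Oz.
  exists (Num.min r r2); first by rewrite lt_min r0.
  move=> z'; rewrite /eball/= lt_min => /andP[z'r /H2 Oz'].
  apply: le_lt_trans h2; rewrite -lee_fin gE//.
  apply/ereal_supP => _ [y' y'B <-]; apply: ltW.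
  apply: (rP (y' - (z' - z))).
    by move: y'B; rewrite /B/= opprB addrAC addrA subrK.
  by rewrite /eball/= opprB addrC subrK.
have glb z : O z -> bdd_below_at g z.
  move=> [x Kx xz]; exists (u x - e).
  have [r r0 H] := open_eball (@eball_open _ _ x d) xz.
  by exists r => // y /H xy; have /andP[] := gb x y Kx xy.
exists d, g; split => //.
- move=> z Oz; split; [exact: gusc|exact: glb|].
  move=> b eta eta0; have [x Kx xz] := Oz.
  have [r r0 H] := open_eball (@eball_open _ _ x d) xz.
  have [rho0 rho00 arcr] := small_arc z b r0.
  exists rho0 => // rho rhoP; have /andP[rho_gt0 rho_lt] := rhoP.
  have Oarc t : O (arc z b rho t) by exists x => //; apply: H; apply: arcr.
  have gi : circle_integrable (g \o arc z b rho).
    by apply: arc_integrable => t; [exact: gusc|exact: glb].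
  suff : g z <= circle_mean (g \o arc z b rho).
    by move=> /le_trans; apply; rewrite lerDl mulr_ge0 ?sqr_ge0// ltW.
  rewrite -lee_fin gE//; apply/ereal_supP => _ [y yB <-].
  have arcB s' t : B (arc z b s' t) (arc y b s' t).
    rewrite /B/=; have -> : arc y b s' t - arc z b s' t = y - z :> CC[R]_n.
      by rewrite /arc opprD addrACA subrr addr0.
    exact: yB.
  have arcO s' t : 0 <= s' <= rho -> O (arc z b s' t).
    move=> /andP[]; rewrite le_eqVlt => /predU1P[<- _|s'0 s'rho].
      by rewrite arc0.
    by exists x => //; apply: H; apply: arcr; rewrite s'0 (le_lt_trans s'rho).
  have [mv vy] := @psh_arc V v y b rho vpsh rho_gt0
    (fun s' t h => BV _ _ (arcO s' t h) (arcB s' t)).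
  apply: le_trans vy _; rewrite -circle_mean_EFin//.
  apply: lee_wpmul2l; first by rewrite lee_fin invr_ge0 ltW// twopi_gt0.
  apply: le_integral_circle => //.
    apply/measurable_EFinP; apply: usc_measurable => t c /gusc[] // r1 r10 H1.
    by near=> t'; apply: H1; near: t'; exact: arc_near.
  by move=> t; apply: vg.
- move=> y x [x' Kx' x'y] Xx xy.
  have : `|u x - u x'| < 2 * e.
    apply: (dP x' Kx' (SX x' Kx')).2 => //; apply: B2 x'y _.
    by rewrite /B/= enormBC ltW.
  have := gb x' y Kx' x'y; rewrite ltr_norml ler_norml /e.
  by move=> /andP[? ?] /andP[? ?]; apply/andP; split; lra.
Unshelve. all: by end_near. Qed.

End sup_regularisation.

(** * Gluing finitely many pieces *)

Section pieces.
Context {R : realType} {n : nat}.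
Implicit Types (z y x a b : CC[R]_n) (u f g : CC[R]_n -> R) (O : set CC[R]_n).

Definition locally x (P : CC[R]_n -> Prop) :=
  exists2 r : R, 0 < r & forall y, eball x r y -> P y.

Lemma locally_and x (P Q : CC[R]_n -> Prop) :
  locally x P -> locally x Q -> locally x (fun y => P y /\ Q y).
Proof.
move=> [r r0 rP] [s s0 sQ]; exists (Num.min r s); first by rewrite lt_min r0.
by move=> y; rewrite /eball/= lt_min => /andP[/rP ? /sQ ?].
Qed.

Lemma locally_open O x : open O -> O x -> locally x O.
Proof. exact: open_eball. Qed.

Lemma locally_enorm_lt c x (r : R) : enorm (x - c) < r ->
  locally x (fun y => enorm (y - c) < r).
Proof.
move=> xr; have [|s s0 H] := @cont_at_enormB R n c x (r - enorm (x - c)).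
  by rewrite subr_gt0.
by exists s => // y /H; rewrite ltr_norml => /andP[_]; lra.
Qed.

Lemma locally_enorm_gt c x (r : R) : r < enorm (x - c) ->
  locally x (fun y => r < enorm (y - c)).
Proof.
move=> xr; have [|s s0 H] := @cont_at_enormB R n c x (enorm (x - c) - r).
  by rewrite subr_gt0.
by exists s => // y /H; rewrite ltr_norml => /andP[]; lra.
Qed.

Context (X : set CC[R]_n) (u : CC[R]_n -> R) (eta M T C kappa : R)
  (A B : finType) (a : A -> CC[R]_n) (rad delta : A -> R)
  (K : A -> set CC[R]_n) (g : A -> CC[R]_n -> R)
  (c p : B -> CC[R]_n) (r osc : B -> R).

(** A multiple of |z|^2 with this factor compensates the concave bumps of all
    pieces at once. *)
Definition curvature : R := \sum_i (rad i ^+ 2)^-1.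

(** The size of the bumps, so small that on the part of [X] in its ball a bump
    is at most eta / 4 in absolute value. *)
Definition margin : R := eta / (4 * (curvature * M ^+ 2 + 1)).

Definition bump i z : R :=
  margin * curvature * enorm z ^+ 2 - margin / rad i ^+ 2 * enorm (z - a i) ^+ 2.

(** The difference of the k-th pole between two spheres whose radii have ratio
    kappa is [osc k + eta]. *)
Definition amp k : R := (osc k + eta) / ln kappa.

Definition pole k z : R := amp k * (ln (enorm (z - c k)) + - ln T).

Definition poles z : R := \sum_k pole k z.

Definition thick i : set CC[R]_n :=
  [set z | exists2 x, K i x & eball x (delta i) z].

(** The index [inl i] stands for a neighbourhood where [u] has an approximant,
    with the balls removed, and [inr k] for the enlargement of the k-th ball. *)
Definition piece_dom (s : A + B) : set CC[R]_n :=
  match s with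
  | inl i => eball (a i) (rad i) `&` thick i
             `&` [set z | forall k, r k < enorm (z - c k)]
  | inr k => eball (c k) (kappa ^+ 4 * r k)
  end.

(** In the piece [inr k] the k-th pole is frozen at its value on the sphere of
    radius kappa^2 r_k, halfway between the two spheres where it has to win and
    to lose. *)
Definition piece (s : A + B) z : R :=
  match s with
  | inl i => g i z + (bump i z + poles z)
  | inr k => \sum_(j | j != k) pole j z +
             (u (p k) + amp k * (ln (kappa ^+ 2 * r k) - ln T))
  end.

Context (eta0 : 0 < eta) (XM : forall x, X x -> enorm x <= M)
  (rad0 : forall i, 0 < rad i) (delta0 : forall i, 0 < delta i)
  (glpsh : forall i, lpsh (thick i) (g i))
  (gu : forall i y x, thick i y -> X x -> eball x (delta i) y ->
    `|g i y - u x| <= margin / 4)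
  (Kball : forall i x, X x -> enorm (x - a i) < rad i -> K i x)
  (kap1 : 1 < kappa) (kapC : kappa ^+ 5 <= C)
  (r0 : forall k, 0 < r k) (osc0 : forall k, 0 <= osc k)
  (oscP : forall k x, X x -> enorm (x - c k) < C * r k ->
    `|u x - u (p k)| <= osc k)
  (sep : forall j k, j <> k -> r j + C * r k <= enorm (c j - c k))
  (XT : forall k x, X x -> enorm (x - c k) <= T) (rT : forall k, r k <= T)
  (cover : forall x, X x -> (exists i, enorm (x - a i) < rad i / 2) \/
                            (exists k, enorm (x - c k) < r k)).

Lemma kappa_gt0 : 0 < kappa. Proof. exact: lt_trans kap1. Qed.

Lemma ln_kappa_gt0 : 0 < ln kappa. Proof. by rewrite ln_gt0. Qed.

Lemma amp_ge0 k : 0 <= amp k.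
Proof. by rewrite divr_ge0 ?addr_ge0// ltW// ln_kappa_gt0. Qed.

Lemma ampE k : amp k * ln kappa = osc k + eta.
Proof. by rewrite /amp divfK// gt_eqF// ln_kappa_gt0. Qed.

Lemma curvature_ge i : (rad i ^+ 2)^-1 <= curvature.
Proof.
rewrite /curvature (bigD1 i)//= lerDl sumr_ge0// => j _.
by rewrite invr_ge0 sqr_ge0.
Qed.

Lemma curvature_ge0 : 0 <= curvature.
Proof. by apply: sumr_ge0 => j _; rewrite invr_ge0 sqr_ge0. Qed.

Lemma margin_gt0 : 0 < margin.
Proof.
rewrite divr_gt0// mulr_gt0// ltr_wpDl// mulr_ge0 ?sqr_ge0//.
exact: curvature_ge0.
Qed.

Lemma marginE : margin * (curvature * M ^+ 2) + margin = eta / 4.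
Proof.
rewrite /margin; field; rewrite gt_eqF// ltr_wpDl// mulr_ge0 ?sqr_ge0//.
exact: curvature_ge0.
Qed.

Lemma margin_le : margin <= eta / 4.
Proof.
rewrite -marginE lerDr mulr_ge0 ?(ltW margin_gt0)// mulr_ge0 ?sqr_ge0//.
exact: curvature_ge0.
Qed.

Lemma margin_curvature_ge0 x : 0 <= margin * curvature * enorm x ^+ 2.
Proof.
apply: mulr_ge0 (sqr_ge0 _); apply: mulr_ge0 curvature_ge0.
exact: ltW margin_gt0.
Qed.

Lemma bump_le i x : X x -> bump i x <= eta / 4 - margin.
Proof.
move=> Xx; have xM := XM Xx; have m0 := margin_gt0.
have x2 : enorm x ^+ 2 <= M ^+ 2.
  by rewrite ler_pXn2r ?nnegrE ?enorm_ge0// (le_trans _ xM)// enorm_ge0.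
have h1 : margin * curvature * enorm x ^+ 2 <= margin * (curvature * M ^+ 2).
  by rewrite -mulrA ler_pM2l// ler_wpM2l// curvature_ge0.
have h2 : 0 <= margin / rad i ^+ 2 * enorm (x - a i) ^+ 2.
  by rewrite mulr_ge0 ?sqr_ge0// divr_ge0 ?sqr_ge0// ltW.
by have := marginE; rewrite /bump; lra.
Qed.

Lemma bump_inside i x (t : R) : 0 <= t -> enorm (x - a i) <= t * rad i ->
  margin * curvature * enorm x ^+ 2 - margin * t ^+ 2 <= bump i x.
Proof.
move=> t0 xt; rewrite /bump lerD2l lerN2 -mulrA ler_pM2l ?margin_gt0//.
rewrite mulrC ler_pdivrMr ?exprn_gt0// -exprMn.
by rewrite ler_pXn2r ?nnegrE ?enorm_ge0// mulr_ge0// ltW.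
Qed.

Lemma bump_outside i x : rad i <= enorm (x - a i) ->
  bump i x <= margin * curvature * enorm x ^+ 2 - margin.
Proof.
move=> xt; rewrite /bump lerD2l lerN2 -mulrA -[leLHS]mulr1 ler_pM2l ?margin_gt0//.
rewrite mulrC ler_pdivlMr ?exprn_gt0// mul1r.
by rewrite ler_pXn2r ?nnegrE ?enorm_ge0// ltW.
Qed.

Lemma bump_cont i x : cont_at (bump i) x.
Proof.
have -> : bump i = fun z => margin * curvature * enorm (z - 0) ^+ 2 +
    (- (margin / rad i ^+ 2)) * enorm (z - a i) ^+ 2.
  by apply/funext => z; rewrite /bump subr0 mulNr.
by apply: cont_atD; [apply: (cont_at_comp (@continuous_sqr R (margin * curvature)))|
  apply: (cont_at_comp (@continuous_sqr R (- (margin / rad i ^+ 2))))];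
  apply: cont_at_enormB.
Qed.

Lemma r_lt_kappa k : r k < kappa ^+ 4 * r k.
Proof. by rewrite ltr_pMl// exprn_egt1. Qed.

Lemma kappa_lt_C k : kappa ^+ 4 * r k < C * r k.
Proof.
rewrite ltr_pM2r//; apply: lt_le_trans kapC.
by rewrite [ltRHS]exprS ltr_pMl// exprn_gt0// kappa_gt0.
Qed.

Lemma far_from_others j k z :
  j <> k -> enorm (z - c k) < C * r k -> r j < enorm (z - c j).
Proof.
move=> jk zk; have := sep jk; have := ler_enormB (c j) z (c k).
rewrite (enormBC (c j) z); move: zk.
by move: (enorm _) (enorm _) (enorm _) => e1 e2 e3; lra.
Qed.

Lemma thick_open i : open (thick i).
Proof.
apply: eball_openP => z [x Kx xz].
have [s s0 sH] := open_eball (@eball_open _ _ x _) xz.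
by exists s => // y /sH ?; exists x.
Qed.

Lemma piece_dom_open s : open (piece_dom s).
Proof.
case: s => [i|k] /=; last exact: eball_open.
apply: openI; first by apply: openI; [exact: eball_open|exact: thick_open].
apply: eball_openP => z zk.
have [||s s0 sP] := @fin_radius R B (fun k s => forall y, eball z s y ->
  r k < enorm (y - c k)).
- by move=> k s s' _ s's sP y ys; apply: sP; apply: lt_le_trans s's.
- by move=> k; apply: locally_enorm_gt.
- by exists s => // y ys k; apply: sP.
Qed.

Lemma pole_lpsh k (P : set CC[R]_n) : open P -> (forall z, P z -> z <> c k) ->
  lpsh P (pole k).
Proof.
move=> oP zP; apply: lpshZ => //; first exact: amp_ge0.
apply: lpshD => //; last exact: lpsh_cst.
by apply: lpsh_sub (@lpsh_ln R n (c k)) => z /zP.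
Qed.

Lemma piece_lpsh s : lpsh (piece_dom s) (piece s).
Proof.
have off k z : r k < enorm (z - c k) -> z <> c k.
  by move=> zk zc; move: zk; rewrite zc subrr enorm0 ltNge (ltW (r0 k)).
have oO := @piece_dom_open s; case: s oO => [i|k] oO.
  have Hh : lpsh (piece_dom (inl i)) poles.
    apply: lpsh_sum => // k _; apply: pole_lpsh => // z [_ /(_ k) zk].
    exact: off zk.
  have Hq : lpsh (piece_dom (inl i)) (bump i).
    by apply: lpsh_quad => //; rewrite ler_pM2l ?margin_gt0 ?curvature_ge.
  apply: lpshD => //; last exact: lpshD.
  by apply: lpsh_sub (glpsh (i := i)); move=> z [[]].
apply: lpshD => //; last exact: lpsh_cst.
apply: lpsh_sum => // j /eqP jk; apply: pole_lpsh => // z zk.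
by apply: off; apply: far_from_others jk (lt_trans zk (kappa_lt_C k)).
Qed.

(** With all poles written in front, the pieces are compared through the
    remaining terms. *)
Lemma piece_inrE k y : piece (inr k) y = poles y +
  (u (p k) + amp k * (ln (kappa ^+ 2 * r k) - ln (enorm (y - c k)))).
Proof.
rewrite /piece /poles [in RHS](bigD1 k)//=.
have -> : pole k y = amp k * (ln (enorm (y - c k)) - ln T) by [].
by move: (\sum_(j | j != k) pole j y) => t; ring.
Qed.

Lemma piece_inl_near i x : X x -> locally x (fun y => thick i y ->
  `|piece (inl i) y - (poles y + (u x + bump i x))| <= margin / 4 + margin / 16).
Proof.
move=> Xx; have m16 : 0 < margin / 16 by rewrite divr_gt0// margin_gt0.
have xd : eball x (delta i) x by rewrite /eball/= subrr enorm0.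
have [s s0 sP] := locally_and (@bump_cont i x _ m16)
   (locally_open (@eball_open _ _ x (delta i)) xd).
exists s => // y /sP[qy xy] Ny /=.
have := gu Ny Xx xy; move: qy; rewrite ltr_norml !ler_norml.
by move: (g i y) (bump i y) (bump i x) (poles y) => *; lra.
Qed.

Lemma ln_kappa_r k (m : nat) :
  ln (kappa ^+ m * r k) = m%:R * ln kappa + ln (r k).
Proof.
by rewrite lnM ?posrE ?exprn_gt0 ?kappa_gt0// lnXn ?kappa_gt0// mulr_natl.
Qed.

Lemma core_cover x : X x -> (exists k, enorm (x - c k) <= r k) \/
  ((forall k, r k < enorm (x - c k)) /\
   exists2 i, enorm (x - a i) < rad i / 2 & piece_dom (inl i) x).
Proof.
move=> Xx; have [[k xk]|no] := pselect (exists k, enorm (x - c k) <= r k).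
  by left; exists k.
have far k : r k < enorm (x - c k).
  by rewrite ltNge; apply/negP => xk; apply: no; exists k.
right; split => //; have [[i xi]|[k xk]] := cover Xx; last first.
  by have := far k; rewrite ltNge (ltW xk).
have xi' : enorm (x - a i) < rad i by have := rad0 i; lra.
exists i => //; split; last exact: far.
split => //; exists x; first exact: Kball.
by rewrite /eball/= subrr enorm0.
Qed.

(** Near the closed ball the pole is below its frozen value by more than the
    oscillation of [u]. *)
Lemma dominated_near_ball i k x : X x -> enorm (x - c k) <= r k ->
  locally x (fun y => piece_dom (inl i) y -> piece (inl i) y <= piece (inr k) y).
Proof.
move=> Xx xk; have xk1 : enorm (x - c k) < kappa * r k.
  by apply: le_lt_trans xk _; rewrite ltr_pMl.
have [s s0 sP] := locally_and (locally_enorm_lt xk1) (piece_inl_near i Xx).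
exists s => // y /sP[yk fy] [[_ Ny] /(_ k) ky].
have y0 : 0 < enorm (y - c k) by apply: lt_trans ky.
have := fy Ny; rewrite piece_inrE ln_kappa_r.
have hln : ln (enorm (y - c k)) <= ln kappa + ln (r k).
  rewrite -lnM ?posrE ?kappa_gt0// ler_ln ?posrE//; first exact: ltW.
  by rewrite mulr_gt0 ?kappa_gt0.
have : `|u x - u (p k)| <= osc k.
  apply: oscP => //; apply: le_lt_trans xk _.
  exact: lt_trans (r_lt_kappa k) (kappa_lt_C k).
have := bump_le i Xx.
have : amp k * ln kappa <= amp k * (2%:R * ln kappa + ln (r k) - ln (enorm (y - c k))).
  by rewrite ler_wpM2l ?amp_ge0//; lra.
have := margin_gt0; rewrite ampE !ler_norml.
move: (amp k * _) (piece (inl i) y) (poles y) (bump i x) (u x) (u (p k)).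
move: (margin) (osc k) eta0 => m o e0 q1 q2 q3 q4 q5 q6 hh1 hh2 hh3 /andP[hh4 hh5] /andP[hh6 hh7].
lra.
Qed.

(** The approximants agree up to the margin, and the bump of a piece on the
    bounding sphere is below the bump of a piece covering x with half its radius. *)
Lemma dominated_near_sphere i i' x : X x -> rad i <= enorm (x - a i) ->
  enorm (x - a i') < rad i' / 2 -> piece_dom (inl i') x ->
  locally x (fun y => piece_dom (inl i) y -> piece (inl i) y <= piece (inl i') y).
Proof.
move=> Xx xi xi' Oi'.
have [s s0 sP] := locally_and (locally_open (@piece_dom_open (inl i')) Oi')
  (locally_and (piece_inl_near i Xx) (piece_inl_near i' Xx)).
exists s => // y /sP[Oy' [fy fy']] Oy.
have := fy Oy.1.2; have := fy' Oy'.1.2; rewrite !ler_norml.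
have := @bump_inside i' x 2^-1; rewrite mulrC => /(_ _ (ltW xi')).
rewrite invr_ge0 ler0n => /(_ isT).
have := bump_outside xi; have := margin_gt0.
move: (piece (inl i) y) (piece (inl i') y) (poles y) (bump i x) (bump i' x).
by move=> *; lra.
Qed.

(** Near the outer sphere the pole has risen above its frozen value by more than
    the oscillation of [u]. *)
Lemma dominated_off_ball i k x : X x ->
  kappa ^+ 4 * r k <= enorm (x - c k) -> enorm (x - c k) < C * r k ->
  enorm (x - a i) < rad i / 2 -> piece_dom (inl i) x ->
  locally x (fun y => piece (inr k) y <= piece (inl i) y).
Proof.
move=> Xx xk xC xi Oi.
have k3 : kappa ^+ 3 * r k < enorm (x - c k).
  apply: lt_le_trans xk; rewrite ltr_pM2r// [ltRHS]exprS ltr_pMl//.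
  by rewrite exprn_gt0// kappa_gt0.
have [s s0 sP] := locally_and (locally_open (@piece_dom_open (inl i)) Oi)
  (locally_and (piece_inl_near i Xx) (locally_enorm_gt k3)).
exists s => // y /sP[Oy [fy yk]].
have k30 : 0 < kappa ^+ 3 * r k by rewrite mulr_gt0// exprn_gt0// kappa_gt0.
have y0 : 0 < enorm (y - c k) by apply: lt_trans yk.
have := fy Oy.1.2; rewrite piece_inrE ln_kappa_r.
have hln : 3%:R * ln kappa + ln (r k) <= ln (enorm (y - c k)).
  by rewrite -ln_kappa_r ler_ln ?posrE// ltW.
have : `|u x - u (p k)| <= osc k by apply: oscP.
have : amp k * (2%:R * ln kappa + ln (r k) - ln (enorm (y - c k))) <=
    amp k * - ln kappa.
  by rewrite ler_wpM2l ?amp_ge0//; lra.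
rewrite mulrN ampE !ler_norml.
have := @bump_inside i x 2^-1; rewrite mulrC => /(_ _ (ltW xi)).
rewrite invr_ge0 ler0n => /(_ isT).
have := margin_curvature_ge0 x; have := margin_le; have := margin_gt0.
move: (amp k * _) (piece (inl i) y) (poles y) (bump i x)
  (margin * curvature * enorm x ^+ 2) => *; lra.
Qed.

(** The domain of a piece can end at x in three ways: x lies on a removed ball, on
    the sphere around a_i, or on the outer sphere of an enlarged ball. *)
Lemma pieces_dominated x (s : A + B) : X x -> ~ piece_dom s x ->
  exists2 t : R, 0 < t & forall y, eball x t y -> piece_dom s y ->
    exists k, piece_dom k x /\ piece s y <= piece k y.
Proof.
move=> Xx; case: s => [i|k] nO.
  have [[k xk]|[far [i' xi' Oi']]] := core_cover Xx.
    have [t t0 tP] := dominated_near_ball i Xx xk; exists t => // y yt Oy.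
    exists (inr k); split; first exact: le_lt_trans xk (r_lt_kappa k).
    exact: tP.
  have xi : rad i <= enorm (x - a i).
    rewrite leNgt; apply/negP => xi; apply: nO; split => //; split => //.
    by exists x; [exact: Kball|rewrite /eball/= subrr enorm0].
  have [t t0 tP] := dominated_near_sphere Xx xi xi' Oi'.
  by exists t => // y yt Oy; exists (inl i'); split => //; apply: tP.
have [Cx|xC] := leP (C * r k) (enorm (x - c k)).
  have [t t0 tP] := locally_enorm_gt (lt_le_trans (kappa_lt_C k) Cx).
  by exists t => // y /tP ky yk; have := lt_trans ky yk; rewrite ltxx.
have xk : kappa ^+ 4 * r k <= enorm (x - c k) by rewrite leNgt; apply/negP.
have [[j xj]|[far [i xi Oi]]] := core_cover Xx.
  have [jk|/eqP jk] := eqVneq j k.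
    by move: (lt_le_trans (r_lt_kappa k) xk); rewrite -jk ltNge xj.
  by have := far_from_others jk xC; rewrite ltNge xj.
have [t t0 tP] := dominated_off_ball Xx xk xC xi Oi.
by exists t => // y yt _; exists (inl i); split => //; apply: tP.
Qed.

Lemma pole_bounds k x : X x -> r k < enorm (x - c k) ->
  - (amp k * (ln T - ln (r k))) <= pole k x <= 0.
Proof.
move=> Xx xk; have x0 : 0 < enorm (x - c k) by apply: lt_trans xk.
have T0 : 0 < T by apply: lt_le_trans (rT k).
have lT : ln (enorm (x - c k)) <= ln T by rewrite ler_ln ?posrE// XT.
have lr : ln (r k) <= ln (enorm (x - c k)) by rewrite ler_ln ?posrE// ltW.
apply/andP; split; last by rewrite mulr_ge0_le0 ?amp_ge0//; lra.
by rewrite -mulrN ler_wpM2l ?amp_ge0//; lra.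
Qed.

(** On each piece the visible poles are only seen from outside their balls, and
    freezing a pole adds a multiple of the oscillation to its cost. *)
Lemma piece_error x (s : A + B) : X x -> piece_dom s x ->
  `|piece s x - u x| <=
    \sum_k (amp k * (ln T - ln (r k)) + 3 * osc k) + 3 * eta.
Proof.
move=> Xx; pose e k := amp k * (ln T - ln (r k)).
have e0 k : 0 <= e k.
  rewrite mulr_ge0 ?amp_ge0// subr_ge0 ler_ln ?posrE//.
  exact: lt_le_trans (rT k).
have -> : \sum_k (amp k * (ln T - ln (r k)) + 3 * osc k) =
    \sum_k e k + 3 * \sum_k osc k by rewrite big_split/= -mulr_sumr.
have osum0 : 0 <= \sum_k osc k by apply: sumr_ge0.
have m0 := margin_gt0; have m4 := margin_le.
case: s => [i [[xi Ni] far]|k xk].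
  have hh : - \sum_k e k <= poles x <= 0.
    rewrite /poles -sumrN; apply/andP; split.
      by apply: ler_sum => k _; have /andP[] := pole_bounds Xx (far k).
    by apply: sumr_le0 => k _; have /andP[] := pole_bounds Xx (far k).
  have [t t0 /(_ x)] := piece_inl_near i Xx.
  rewrite {1}/eball/= subrr enorm0 => /(_ t0 Ni).
  have := bump_le i Xx.
  have := @bump_inside i x 1 ler01; rewrite mul1r => /(_ (ltW xi)).
  have := margin_curvature_ge0 x; move: hh => /andP[].
  rewrite !ler_norml expr1n mulr1.
  move: (piece (inl i) x) (poles x) (bump i x) (\sum_k e k) (\sum_k osc k) osum0
    (margin * curvature * enorm x ^+ 2) => *; lra.
have hh : - \sum_(j | j != k) e j <= \sum_(j | j != k) pole j x <= 0.
  have far j : j != k -> r j < enorm (x - c j).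
    by move=> /eqP jk; apply: far_from_others jk _; apply: lt_trans xk (kappa_lt_C k).
  rewrite -sumrN; apply/andP; split.
    by apply: ler_sum => j /far /(pole_bounds Xx) /andP[].
  by apply: sumr_le0 => j /far /(pole_bounds Xx) /andP[].
have oscx : `|u x - u (p k)| <= osc k.
  by apply: oscP => //; apply: lt_trans xk (kappa_lt_C k).
have E1 : \sum_k e k = e k + \sum_(j | j != k) e j by rewrite (bigD1 k).
have E2 : \sum_k osc k = osc k + \sum_(j | j != k) osc j by rewrite (bigD1 k).
rewrite E1 E2 /piece ln_kappa_r.
have o1 : 0 <= \sum_(j | j != k) osc j by apply: sumr_ge0.
have ee : amp k * (2%:R * ln kappa + ln (r k) - ln T) = 2 * (osc k + eta) - e k.
  by rewrite -ampE /e; ring.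
rewrite ee; move: hh oscx (e0 k) (osc0 k) => /andP[].
rewrite !ler_norml.
move: (\sum_(j | j != k) pole j x) (\sum_(j | j != k) e j)
  (\sum_(j | j != k) osc j) o1 (e k) => *.
lra.
Qed.

Lemma pieces_glue : exists W w, [/\ open W, X `<=` W, lpsh W w &
  forall x, X x -> `|w x - u x| <=
    \sum_k (amp k * (ln T - ln (r k)) + 3 * osc k) + 3 * eta].
Proof.
have [||W [w [oW XW wl wx]]] :=
  @lpsh_glue R n (A + B)%type piece_dom piece X
    (fun s => @piece_dom_open s) (fun s => @piece_lpsh s).
- move=> x /core_cover[[k xk]|[_ [i _ xi]]]; last by exists (inl i).
  by exists (inr k); apply: le_lt_trans xk (r_lt_kappa k).
- by move=> x s; apply: pieces_dominated.
exists W, w; split => // x Xx.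
by have [s Os ->] := wx x Xx; apply: piece_error.
Qed.

End pieces.

Lemma finite_gluing {R : realType} {n : nat} (X : set CC[R]_n)
    (u : CC[R]_n -> R) (eta M T C kappa : R)
    (A B : finType) (a : A -> CC[R]_n) (rad : A -> R) (S : A -> set CC[R]_n)
    (c p : B -> CC[R]_n) (r osc : B -> R) :
  0 < eta -> {within X, continuous u} -> (forall x, X x -> enorm x <= M) ->
  (forall i, 0 < rad i) ->
  (forall i, psh_closure (S i) u) -> (forall i, closure (S i) `<=` X) ->
  (forall i x, X x -> enorm (x - a i) < rad i -> closure (S i) x) ->
  1 < kappa -> kappa ^+ 5 <= C ->
  (forall k, 0 < r k) -> (forall k, 0 <= osc k) ->
  (forall k x, X x -> enorm (x - c k) < C * r k -> `|u x - u (p k)| <= osc k) ->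
  (forall j k, j <> k -> r j + C * r k <= enorm (c j - c k)) ->
  (forall k x, X x -> enorm (x - c k) <= T) -> (forall k, r k <= T) ->
  (forall x, X x -> (exists i, enorm (x - a i) < rad i / 2) \/
                    (exists k, enorm (x - c k) < r k)) ->
  exists W w, [/\ open W, X `<=` W, lpsh W w &
    forall x, X x -> `|w x - u x| <=
      \sum_k ((osc k + eta) / ln kappa * (ln T - ln (r k)) + 3 * osc k) + 3 * eta].
Proof.
move=> eta0 cu XM rad0 Spsh SX Sball kap1 kapC r0 osc0 oscP sep XT rT cover.
have m0 : 0 < margin eta M rad / 4 by rewrite divr_gt0// margin_gt0.
have SM i z : S i z -> enorm z <= M by move=> /subset_closure /SX /XM.
have /choice[dg dgP] : forall i, exists dg : R * (CC[R]_n -> R),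
    [/\ 0 < dg.1, lpsh [set z | exists2 x, closure (S i) x & eball x dg.1 z] dg.2 &
    forall y x, (exists2 x', closure (S i) x' & eball x' dg.1 y) -> X x ->
      eball x dg.1 y -> `|dg.2 y - u x| <= margin eta M rad / 4].
  move=> i; have [d [g [H1 H2 H3]]] :=
    sup_regularisation cu (@SX i) (@SM i) (Spsh i) m0.
  by exists (d, g); split.
apply: (@pieces_glue R n X u eta M T C kappa A B a rad (fun i => (dg i).1)
  (fun i => closure (S i)) (fun i => (dg i).2) c p r osc) => //.
- by move=> i; have [] := dgP i.
- by move=> i; have [] := dgP i.
- by move=> i y x; have [_ _] := dgP i; apply.
Qed.

(** * Covering and gauge estimates *)

Section assembly.
Context {R : realType} {n : nat}.
Implicit Types (z y x a b : CC[R]_n).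

Lemma psh_closure_approx (S : set CC[R]_n) (u : CC[R]_n -> R) :
  (forall eps, 0 < eps -> exists W w, [/\ open W, closure S `<=` W, lpsh W w &
     forall x, closure S x -> `|w x - u x| <= eps]) ->
  psh_closure S u.
Proof.
move=> H.
have /choice[Ww WwP] : forall j : nat, exists Ww : set CC[R]_n * (CC[R]_n -> R),
    [/\ open Ww.1, closure S `<=` Ww.1, lpsh Ww.1 Ww.2 &
     forall x, closure S x -> `|Ww.2 x - u x| <= j.+1%:R^-1].
  move=> j; have [|W [w [? ? ? ?]]] := H j.+1%:R^-1; first by rewrite invr_gt0.
  by exists (W, w); split.
pose V j : set CC[R]_n := [set z | forall i : 'I_j.+1, (Ww i).1 z].
have VW j : V j `<=` (Ww j).1 by move=> z /(_ ord_max).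
have oV j : open (V j).
  apply: eball_openP => z Vz.
  have [||s s0 sP] := @fin_radius R 'I_j.+1 (fun i s => eball z s `<=` (Ww i).1).
  - by move=> k s s' _ s's sP y ys; apply: sP; apply: lt_le_trans s's.
  - by move=> k; apply: open_eball (Vz k); have [] := WwP k.
  - by exists s => // y ys i; apply: sP ys.
exists V, (fun j => EFin \o (Ww j).2); split.
- by move=> j; split => // z Sz i; have [_ /(_ z Sz)] := WwP i.
- move=> i j ij z Vz k.
  have kj : (k < j.+1)%N by apply: leq_trans (ltn_ord k) _; rewrite ltnS.
  exact: (Vz (Ordinal kj)).
- move=> j; have [oW _ lW _] := WwP j.
  apply: lpsh_psh; last exact: lpsh_sub (VW j) lW.
  exact: oV.
- move=> eps eps0; near=> j => z Sz.
  have [_ _ _ /(_ z Sz) h] := WwP j.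
  rewrite /= lee_fin; apply: le_trans h _.
  have ej : eps^-1 <= j%:R by near: j; exact: nbhs_infty_ger.
  rewrite -[eps]invrK lef_pV2 ?posrE ?invr_gt0 ?ltr0n//.
  by apply: le_trans ej _; rewrite ler_nat.
Unshelve. all: by end_near. Qed.

(** If the centres were closer, the point dividing the segment between them in
    the ratio of the radii would lie in both balls. *)
Lemma separated_centres (a b : CC[R]_n) (r s : R) : 0 < r -> 0 < s ->
  eball a r `&` eball b s = set0 -> r + s <= enorm (a - b).
Proof.
move=> r0 s0 ab; rewrite leNgt; apply/negP => d.
have rs0 : 0 < r + s by rewrite addr_gt0.
pose t := r / (r + s).
have t0 : 0 < t by rewrite divr_gt0.
have tr : t * (r + s) = r by rewrite /t divfK// gt_eqF.
have tE (k : R) : Normc.normc (k%:C%C) = `|k|.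
  by rewrite /= expr0n addr0 sqrtr_sqr.
suff : (eball a r `&` eball b s) (a + (t%:C%C : CC[R]) *: (b - a)) by rewrite ab.
split; rewrite /eball/=.
  rewrite addrC addKr enormZ tE gtr0_norm// enormBC -tr.
  by rewrite ltr_pM2l.
have -> : a + (t%:C%C : CC[R]) *: (b - a) - b = ((1 - t)%:C%C : CC[R]) *: (a - b).
  rewrite rmorphB/= scalerBl scale1r -[b - a]opprB scalerN.
  by rewrite addrAC.
have t1 : 0 < 1 - t by rewrite subr_gt0 /t ltr_pdivrMr// mul1r ltrDl.
rewrite enormZ tE gtr0_norm//; have : (1 - t) * enorm (a - b) < (1 - t) * (r + s).
  by rewrite ltr_pM2l.
by have -> : (1 - t) * (r + s) = s by rewrite mulrBl mul1r tr; ring.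
Qed.

(** If s <= r then r is the midpoint of s and 2 r - s; otherwise r is a convex
    combination of s and 0. *)
Lemma concave_modulus_le (omega : \bar R -> \bar R) (r s K w : R) :
  (forall t, (0 <= t)%E -> (0 <= omega t)%E) -> concave_modulus omega ->
  0 < r -> 0 <= s -> s <= K * r -> 2 <= K -> omega r%:E = w%:E ->
  (omega s%:E <= (K * w)%:E)%E.
Proof.
move=> om0 conc r0 s0 sK K2 ow.
have w0 : 0 <= w by rewrite -lee_fin -ow om0// lee_fin ltW.
have step (t y : R) : 0 < t <= 1 -> 0 <= y -> t * s + (1 - t) * y = r ->
    (omega s%:E <= (t^-1 * w)%:E)%E.
  move=> /andP[t0 t1] y0 E.
  have := @conc s%:E y%:E t; rewrite !lee_fin s0 y0 (ltW t0) t1.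
  move=> /(_ isT isT isT); rewrite -!EFinM -EFinD E ow => H.
  have oy : (0 <= (1 - t)%:E * omega y%:E)%E.
    by rewrite mule_ge0// ?lee_fin ?subr_ge0// om0// lee_fin.
  rewrite EFinM lee_pdivlMl//; apply: le_trans H.
  by rewrite leeDl.
have [sr|rs] := leP s r.
  apply: le_trans (step 2^-1 (2 * r - s) _ _ _) _.
  - by rewrite invr_gt0 ltr0n/= invf_le1// ler1n.
  - by lra.
  - by field.
  - by rewrite invrK lee_fin ler_wpM2r.
have s00 : 0 < s by apply: lt_trans rs.
apply: le_trans (step (r / s) 0 _ _ _) _ => //.
- by rewrite divr_gt0//= ler_pdivrMr// mul1r ltW.
- by rewrite mulr0 addr0 divfK// gt_eqF.
- by rewrite lee_fin ler_wpM2r// invf_div ler_pdivrMr.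
Qed.

Lemma domain_point_psh_closure (D : set CC[R]_n) (u : CC[R]_n -> R) z :
  open D -> psh D (EFin \o u) -> D z ->
  exists2 U : set CC[R]_n, nbhs z U & psh_closure (U `&` D) u.
Proof.
move=> oD uD Dz; have [r r0 rD] := open_eball oD Dz.
exists (eball z (r / 2)); first by apply: nbhs_eball; rewrite divr_gt0.
exists (fun=> D), (fun=> EFin \o u); split => //.
- move=> _; split => // y /closure_eball /(_ (r / 2)) [|y' [y'z _] yy'].
    by rewrite divr_gt0.
  apply: rD; rewrite /eball/= in y'z *.
  have := ler_enormB y y' z; rewrite (enormBC y y'); move: y'z yy'.
  by move: (enorm _) (enorm _) (enorm _) => e1 e2 e3; lra.
- by move=> i j _ y.
- by move=> eps eps0; exists 0%N => // j _ y _; rewrite /= subrr normr0 lee_fin ltW.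
Qed.

Lemma finite_cover (X G : set CC[R]_n) (rad : CC[R]_n -> R) (J : set nat)
    (z : nat -> CC[R]_n) (r : nat -> R) :
  compact X -> (forall a, G a -> 0 < rad a) ->
  (forall x, X x -> G x \/ exists2 j, J j & eball (z j) (r j) x) ->
  exists (sA : seq CC[R]_n) (sB : seq nat),
    [/\ forall a, a \in sA -> G a, forall j, j \in sB -> J j, uniq sB &
    forall x, X x -> (exists2 a, a \in sA & eball a (rad a) x) \/
                     (exists2 j, j \in sB & eball (z j) (r j) x)].
Proof.
move=> cX rad0 XG.
pose Dm (s : CC[R]_n + nat) : Prop :=
  match s with inl a => G a | inr j => J j end.
pose F (s : CC[R]_n + nat) : set CC[R]_n :=
  match s with inl a => eball a (rad a) | inr j => eball (z j) (r j) end.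
move: cX; rewrite compact_cover => /(_ _ Dm F)[||D' D'D XD'].
- by move=> [a|j] _; exact: eball_open.
- move=> x /XG[Gx|[j Jj jx]]; last by exists (inr j).
  by exists (inl x) => //; rewrite /F /eball/= subrr enorm0; apply: rad0.
pose la (s : CC[R]_n + nat) := if s is inl a then Some a else None.
pose lb (s : CC[R]_n + nat) := if s is inr j then Some j else None.
pose sD : seq (CC[R]_n + nat)%type := finmap.enum_fset D'.
have sDD s : s \in sD -> Dm s by move=> /D'D; rewrite inE.
exists (pmap la sD), (undup (pmap lb sD)); split.
- by move=> a; rewrite mem_pmap => /mapP[[a'|j] /sDD sa //= [->]].
- by move=> j; rewrite mem_undup mem_pmap => /mapP[[a|j'] /sDD sj //= [->]].
- exact: undup_uniq.
- move=> x /XD'[[a|j] sD' xF]; [left; exists a|right; exists j] => //.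
    by rewrite mem_pmap; apply/mapP; exists (inl a).
  by rewrite mem_undup mem_pmap; apply/mapP; exists (inr j).
Qed.

(** The gauge is finite and ln (1 / r) is positive, so omega (r) is finite. *)
Lemma log_gauge_value (omega : \bar R -> \bar R) (phi : R -> R) (t0 r : R) :
  (forall t, (0 <= t)%E -> (0 <= omega t)%E) -> t0 < 1 ->
  (forall t, 0 < t < t0 ->
     (phi t)%:E = (omega t%:E * (ln (1 / t))%:E)%E) ->
  0 < r < t0 ->
  exists w, [/\ 0 <= w, omega r%:E = w%:E & phi r = w * ln (1 / r)].
Proof.
move=> om0 t01 hphi rt0; have /andP[r0 rt] := rt0.
have l0 : 0 < ln (1 / r).
  by rewrite ln_gt0// ltr_pdivlMr// mul1r; apply: lt_trans t01.
have := hphi r rt0; have := om0 r%:E; rewrite lee_fin (ltW r0) => /(_ isT).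
case: (omega r%:E) => [w| |] //.
  by rewrite lee_fin -EFinM => w0 [->]; exists w.
by rewrite gt0_mulye// lte_fin.
Qed.

Lemma sum_le_esum (J : set nat) (phi : nat -> R) (s : seq nat) :
  uniq s -> (forall j, j \in s -> J j) ->
  ((\sum_(j <- s) phi j)%:E <= \esum_(j in J) (phi j)%:E)%E.
Proof.
move=> us sJ; apply: esum_ge; exists [set` s].
  by split; [exact: finite_seq|move=> j /= /sJ].
by rewrite -fsbig_seq// sumEFin.
Qed.

Lemma closure_setI_eball (D U : set CC[R]_n) a x (rad : R) :
  eball a rad `<=` U -> closure D x -> enorm (x - a) < rad ->
  closure (U `&` D) x.
Proof.
move=> aU Dx xa; apply/closure_eball => s s0.
have [d d0 dH] := open_eball (@eball_open _ _ a rad) xa.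
have [|y Dy] := (closure_eball _ _).1 Dx (Num.min s d); first by rewrite lt_min s0.
rewrite lt_min => /andP[xy1 xy2]; exists y => //; split => //.
by apply: aU; apply: dH.
Qed.

(** Since ln (1 / r) >= L0, both ln T and 1 are bounded by multiples of
    ln (1 / r), and so every term is bounded by a multiple of w ln (1 / r). *)
Lemma gluing_cost (C lk lT L0 w eta r : R) : 0 < C -> 0 < lk -> 0 <= lT ->
  0 < L0 -> 0 < r -> L0 <= ln (1 / r) -> 0 <= w ->
  (2 * C * w + eta) / lk * (lT - ln r) + 3 * (2 * C * w) <=
  (2 * C / lk * (lT / L0 + 1) + 3 * (2 * C) / L0) * (w * ln (1 / r))
  + eta * ((lT - ln r) / lk).
Proof.
move=> C0 lk0 lT0 L00 r0 rL w0.
have -> : ln r = - ln (1 / r) by rewrite mul1r lnV// opprK.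
have wL : w <= w * ln (1 / r) / L0 by rewrite ler_pdivlMr// ler_wpM2l.
move: (ln (1 / r)) rL wL => l rL wL.
have -> : (2 * C * w + eta) / lk * (lT - - l) + 3 * (2 * C * w)
   = 2 * C / lk * (lT * w + w * l) + 3 * (2 * C) * w + eta * ((lT - - l) / lk).
  by field; rewrite gt_eqF.
rewrite lerD2r.
have -> : (2 * C / lk * (lT / L0 + 1) + 3 * (2 * C) / L0) * (w * l) =
    2 * C / lk * (lT * (w * l / L0) + w * l) + 3 * (2 * C) * (w * l / L0).
  by field; rewrite !gt_eqF.
apply: lerD; last by rewrite ler_wpM2l// !mulr_ge0// ltW.
rewrite ler_wpM2l//; first by rewrite divr_ge0 ?(ltW lk0)// mulr_ge0// ltW.
by rewrite lerD2r ler_wpM2l.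
Qed.

End assembly.

(** * The theorem *)

Theorem theorem3p5 (R : realType) (n : nat) (D E : set CC[R]_n)
    (u : CC[R]_n -> R) (omega : \bar R -> \bar R) (C : R) (phi : R -> R)
    (hD : bounded_domain D)
    (u_psh : psh D (EFin \o u))
    (u_cont : {within closure D, continuous u})
    (u_omega : modulus_of_continuity (closure D) u omega)
    (omega_concave : concave_modulus omega)
    (hE : E `<=` bdry D)
    (u_loc : forall z, (bdry D `\` E) z ->
       exists2 U : set CC[R]_n, nbhs z U & psh_closure (U `&` D) u)
    (hC : 1 < C)
    (hphi : log_gauge omega phi)
    (hPS : PS C phi E) :
  psh_closure D u.
Proof.
have [oD _ [x0 Dx0] [M DM]] := hD.
pose X := closure D.
have cX : compact X by exact: closure_bounded_compact DM.
have XM : forall x, X x -> enorm x <= M by exact: closure_enorm_le.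
have M0 : 0 <= M by apply: le_trans (DM x0 Dx0); apply: enorm_ge0.
have loc x : X x -> ~ E x -> exists2 U : set CC[R]_n, nbhs x U & psh_closure (U `&` D) u.
  move=> Xx nEx; have [Dx|nDx] := pselect (D x).
    exact: domain_point_psh_closure.
  apply: u_loc; split => //; split => //.
  by move=> /interior_subset.
pose G x := X x /\ ~ E x.
have /choice[rU rUP] : forall x, exists rU : R * set CC[R]_n, G x ->
    [/\ 0 < rU.1, eball x rU.1 `<=` rU.2 & psh_closure (rU.2 `&` D) u].
  move=> x; have [[Xx nEx]|nG] := pselect (G x); last by exists (0, setT).
  have [U /nbhs_eballP[r r0 rU] Uu] := loc x Xx nEx.
  by exists (r, U).
have [om0 omu] := u_omega.
have [phi0 [t0 /andP[t00 t01] [phiE [m m0 phim]]]] := hphi.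
(* kappa^5 <= C leaves room for the spheres of radii kappa^2 r and kappa^4 r,
   each a factor kappa away from where the pole is compared with it *)
pose kappa := expR (ln C / 5).
have lC0 : 0 < ln C by rewrite ln_gt0.
have C0 : 0 < C by lra.
have lk : ln kappa = ln C / 5 by rewrite expRK.
have lk0 : 0 < ln kappa by rewrite lk divr_gt0.
have kap1 : 1 < kappa by rewrite expR_gt1 divr_gt0.
have kapC : kappa ^+ 5 <= C.
  rewrite /kappa -expRM_natl mulrC divfK ?pnatr_eq0//.
  by rewrite lnK// posrE.
pose T := 2 * M + 1.
have T1 : 1 <= T by rewrite /T; lra.
have lT0 : 0 <= ln T by rewrite ln_ge0.
pose L0 := ln (1 / t0).
have L00 : 0 < L0 by rewrite ln_gt0// ltr_pdivlMr// mul1r.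
pose c1 := 2 * C / ln kappa * (ln T / L0 + 1) + 3 * (2 * C) / L0.
have c10 : 0 < c1.
  rewrite ltr_wpDl//; last by rewrite divr_gt0// !mulr_gt0.
  rewrite mulr_ge0// ?addr_ge0// divr_ge0// ltW// mulr_gt0//.
apply: psh_closure_approx => eps eps0.
(* eps' <= m excludes balls of radius at least t0 *)
pose eps' := Num.min m (eps / 2 / c1).
have eps'0 : 0 < eps' by rewrite lt_min m0/= !divr_gt0.
have [J [z [r [r0 EJ sep sumJ]]]] := hPS eps' eps'0.
(* each ball that is kept contains a point p of X at which u can be evaluated *)
pose J' : set nat := [set j | J j /\ exists2 x, X x & eball (z j) (r j) x].
have [||sA [sB [sAG sBJ usB XAB]]] :=
  @finite_cover R n X G (fun x => (rU x).1 / 2) J' z r cX.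
- by move=> x /rUP[r_gt0 _ _]; rewrite divr_gt0.
- move=> x Xx; have [Ex|nEx] := pselect (E x); last by left.
  by right; have [j Jj jx] := EJ x Ex; exists j => //; split => //; exists x.
have phi_sum : \sum_(j <- sB) phi (r j) < eps'.
  rewrite -lte_fin; apply: le_lt_trans sumJ.
  by apply: (@sum_le_esum R J (fun j => phi (r j))) => // j /sBJ[].
have rt0 j : j \in sB -> 0 < r j < t0.
  move=> jB; have Jj := (sBJ j jB).1; rewrite r0//=.
  rewrite ltNge; apply/negP => /phim mphi.
  have : phi (r j) <= \sum_(j <- sB) phi (r j).
    rewrite (bigD1_seq j)//= lerDl.
    rewrite big_seq_cond; apply: sumr_ge0 => i /andP[iB _].
    by apply: phi0; apply: r0; have [] := sBJ i iB.
  have : eps' <= m by rewrite ge_min lexx.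
  by lra.
have [w wP] : exists w : nat -> R, forall j, j \in sB ->
    [/\ 0 <= w j, omega (r j)%:E = (w j)%:E & phi (r j) = w j * ln (1 / r j)].
  suff /choice[w wP] : forall j, exists w, j \in sB ->
      [/\ 0 <= w, omega (r j)%:E = w%:E & phi (r j) = w * ln (1 / r j)] by exists w.
  move=> j; have [jB|] := boolP (j \in sB); last by exists 0.
  have [w ?] := log_gauge_value om0 t01 phiE (rt0 j jB).
  by exists w.
have [p pP] : exists p : nat -> CC[R]_n, forall j, j \in sB ->
    X (p j) /\ eball (z j) (r j) (p j).
  suff /choice[p pP] : forall j, exists p, j \in sB -> X p /\ eball (z j) (r j) p.
    by exists p.
  move=> j; have [/sBJ[_ [x Xx xj]]|] := boolP (j \in sB); last by exists 0.
  by exists x.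
have lr j : j \in sB -> ln (1 / r j) = - ln (r j) /\ L0 <= ln (1 / r j).
  move=> jB; have /andP[rj0 rjt] := rt0 j jB; split.
    by rewrite mul1r lnV.
  by rewrite ler_ln ?posrE ?divr_gt0// ler_pM2l// lef_pV2// ltW.
pose S1 := \sum_(j <- sB) (ln T - ln (r j)) / ln kappa.
have S10 : 0 <= S1.
  rewrite /S1 big_seq_cond; apply: sumr_ge0 => j /andP[jB _].
  by have [-> ] := lr j jB => h; rewrite divr_ge0 ?(ltW lk0)//; lra.
(* eta is chosen after the finite family of balls *)
pose eta := eps / 2 / (S1 + 3).
have S3 : 0 < S1 + 3 by lra.
have eta0 : 0 < eta by rewrite !divr_gt0.
have etaE : eta * (S1 + 3) = eps / 2 by rewrite /eta divfK// gt_eqF.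
pose jB (k : 'I_(size sB)) := nth 0%N sB k.
have jBs k : jB k \in sB by rewrite mem_nth.
pose iA (k : 'I_(size sA)) := nth 0 sA k.
have iAG k : G (iA k) by apply: sAG; rewrite mem_nth.
have [|||||||||||||W [W' [oW XW lW WE]]] := @finite_gluing R n X u eta M T C kappa
  'I_(size sA) 'I_(size sB) iA (fun k => (rU (iA k)).1)
  (fun k => (rU (iA k)).2 `&` D) (z \o jB) (p \o jB) (r \o jB)
  (fun k => 2 * C * w (jB k)) eta0 u_cont XM.
- by move=> k; have [] := rUP _ (iAG k).
- by move=> k; have [] := rUP _ (iAG k).
- by move=> k; apply: closure_subset => y [].
- move=> k x Xx xk; have [_ rUU _] := rUP _ (iAG k).
  exact: closure_setI_eball rUU Xx xk.
- exact: kap1.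
- exact: kapC.
- by move=> k; have /andP[] := rt0 _ (jBs k).
- by move=> k; have [w0 _ _] := wP _ (jBs k); rewrite !mulr_ge0// ltW.
- move=> k x Xx xk; have [Xp pk] := pP _ (jBs k); have [w0 ow _] := wP _ (jBs k).
  have /andP[rk0 _] := rt0 _ (jBs k).
  rewrite -lee_fin; apply: le_trans (omu x _ Xx Xp) _.
  apply: (concave_modulus_le om0 omega_concave rk0 (enorm_ge0 _)) ow; last by lra.
  have := ler_enormB x (z (jB k)) (p (jB k)); rewrite /= in xk.
  rewrite /eball/= in pk; rewrite (enormBC (z (jB k))).
  have : r (jB k) <= C * r (jB k) by rewrite ler_peMl ?(ltW rk0)// ltW.
  move: xk pk; move: (enorm _) (enorm _) (enorm _) (r _) => e1 e2 e3 rr.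
  by lra.
- move=> j k jk; have [Jj Jk] := ((sBJ _ (jBs j)).1, (sBJ _ (jBs k)).1).
  apply: separated_centres; [exact: r0|by rewrite mulr_gt0// r0|].
  apply: sep => //; apply/eqP; apply: contra_not_neq jk => /eqP.
  by rewrite nth_uniq// => /eqP/val_inj.
- move=> k x Xx; have [Xp pk] := pP _ (jBs k).
  have /andP[_ rkt] := rt0 _ (jBs k).
  have := ler_enormB x (p (jB k)) (z (jB k)).
  have := ler_enormD x (- p (jB k)); rewrite enormN.
  have := XM x Xx; have := XM _ Xp; rewrite /eball/= in pk; rewrite /T /=.
  move: pk; move: (enorm (p _ - _)) (enorm (x - p _)) (enorm (x - z _)) => e1 e2 e3.
  by move: (enorm _) (enorm _) => e4 e5; lra.
- move=> k; have /andP[_ rkt] := rt0 _ (jBs k); rewrite /= /T; lra.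
- move=> x /XAB[[a aA xa]|[j jsB xj]].
    left; have ai : (index a sA < size sA)%N by rewrite index_mem.
    by exists (Ordinal ai); rewrite /iA/= nth_index.
  right; have ji : (index j sB < size sB)%N by rewrite index_mem.
  by exists (Ordinal ji); rewrite /jB/= nth_index.
exists W, W'; split => // x Xx; apply: le_trans (WE x Xx) _.
have -> : \sum_k ((2 * C * w (jB k) + eta) / ln kappa *
      (ln T - ln ((r \o jB) k)) + 3 * (2 * C * w (jB k))) =
    \sum_(j <- sB) ((2 * C * w j + eta) / ln kappa *
      (ln T - ln (r j)) + 3 * (2 * C * w j)).
  by rewrite [RHS](big_nth 0%N) big_mkord.
have : \sum_(j <- sB) ((2 * C * w j + eta) / ln kappa *
      (ln T - ln (r j)) + 3 * (2 * C * w j)) <=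
    \sum_(j <- sB) (c1 * phi (r j) + eta * ((ln T - ln (r j)) / ln kappa)).
  rewrite big_seq [leRHS]big_seq; apply: ler_sum => j jsB.
  have [w0 _ ->] := wP j jsB; have [_ lrL] := lr j jsB.
  have /andP[rj0 _] := rt0 j jsB.
  exact: gluing_cost.
have -> : \sum_(j <- sB) (c1 * phi (r j) + eta * ((ln T - ln (r j)) / ln kappa)) =
    c1 * \sum_(j <- sB) phi (r j) + eta * S1.
  by rewrite big_split/= -!mulr_sumr.
move=> h.
have : c1 * \sum_(j <- sB) phi (r j) <= eps / 2.
  have : c1 * \sum_(j <- sB) phi (r j) <= c1 * eps' by rewrite ler_wpM2l// ltW.
  have : c1 * eps' <= eps / 2.
    by rewrite mulrC -ler_pdivlMr// ge_min lexx orbT.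
  by lra.
move: etaE h; rewrite mulrDr; move: (eta * S1) (c1 * _) (\sum_(j <- sB) _) => s1 s2 s3.
by lra.
Qed.
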